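(* Let $f(X)=N(N-1)\sum_{i=1}^{\ell}\beta_i\, t(H_i,X)$ be a subgraph-counting function (finite simple graphs $H_1,\dots,H_\ell$, real weights $\beta_1,\dots,\beta_\ell$), let $$C_{\boldsymbol\beta}=\max\Big\{12\sum_{i=1}^{\ell}|\beta_i|\,|E(H_i)|^2,\;2\Big\},$$ and let $$\mathcal X_f=\Big\{X\in[0,1]^n:\ \Big\|X-\tfrac{\mathbf 1+\tanh(\nabla f(X))}{2}\Big\|_1\le 5000\,C_{\boldsymbol\beta}^2\,n^{15/16}\Big\}.$$ Then there exists a probability measure $\rho$ on $[0,1]^n$ (depending on $n$ and $f$) such that the exponential random graph $G_N^f$ is a $\big(\rho,\,80\,C_{\boldsymbol\beta}\,n^{-1/16}\big)$-mixture and $$\rho(\mathcal X_f)\ge 1-\frac{80\,C_{\boldsymbol\beta}}{n^{1/16}}.$$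
   Context: Fix an integer $N\ge 2$ (number of vertices) and set $n=\binom N2$. Vectors $X\in[0,1]^n$ are identified with symmetric $N\times N$ matrices with zero diagonal whose off-diagonal entries $X_{ij}=X_{ji}$ are indexed by unordered pairs $\{i,j\}$ (edge-weighted graphs on $[N]$); vectors in $\{0,1\}^n$ are identified with simple graphs on $[N]$. For a finite simple graph $H$ on vertex set $[m]$ and $X\in[0,1]^n$, set $t(H,X)=\frac{1}{N(N-1)\cdots(N-m+1)}\sum_{q}\prod_{\{l,l'\}\in E(H)}X_{q_l q_{l'}}$, the sum over all injective maps $q:[m]\to[N]$ (for a simple graph this is the number of injective homomorphisms $H\to G$ divided by $N(N-1)\cdots(N-m+1)$). For an edge index $e=\{i,j\}$, $\partial_e f(X)=\frac12\big(f(X^{e\leftarrow 1})-f(X^{e\leftarrow 0})\big)$, where $X^{e\leftarrow a}$ is $X$ with coordinate $e$ replaced by $a$; $\nabla f(X)=(\partial_e f(X))_{e}\in\mathbb R^n$ (defined for all $X\in[0,1]^n$ since $f$ is affine in each coordinate). $\mathbf 1$ is the matrix with zero diagonal and all off-diagonal entries $1$; $\tanh$ is applied entrywise; $\|\cdot\|_1$ is the $\ell^1$ norm on $\mathbb R^n$. The exponential random graph $G_N^f$ is the random element of $\{0,1\}^n$ with $\Pr[G_N^f=G]=\exp(f(G))/Z$, $Z$ a normalizing constant. For $\vec p\in[0,1]^n$, $G(N,\vec p)$ is the random graph with independent edges, edge $\{i,j\}$ present with probability $\vec p_{ij}$; for a measure $\rho$ on $[0,1]^n$, $G(N,\rho)$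 is defined by $\Pr[G(N,\rho)=G]=\int\Pr[G(N,\vec p)=G]\,d\rho(\vec p)$. A random graph $G$ is a $(\rho,\delta)$-mixture if there is a coupling of $G(N,\rho)$ and $G$ with $\mathbb E\|G(N,\rho)-G\|_1\le\delta n$. *)

(* Defs.v *)
From HB Require Import structures.
From mathcomp Require Import all_boot all_order all_algebra.
From mathcomp Require Import all_classical all_reals all_analysis.
Set Implicit Arguments. Unset Strict Implicit. Unset Printing Implicit Defensive.
Import Order.TTheory GRing.Theory Num.Theory.
Import numFieldNormedType.Exports.
Local Open Scope classical_set_scope.
Local Open Scope ring_scope.

(* Edge indices: unordered pairs {i,j} of distinct vertices of [N],
   represented as ordered pairs (i,j) with i < j.  #|edge N| = 'C(N,2). *)
Definition edge (N : nat) := {p : 'I_N * 'I_N | (p.1 < p.2)%N}.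

Record sgraph := SGraph { sg_order : nat; sg_edges : {set edge sg_order} }.

Section Defs.
Variable R : realType.
Variable N : nat.

Definition nedges : nat := 'C(N, 2).

(* X in R^n seen as a symmetric matrix with zero diagonal. *)
Definition Xadj (X : edge N -> R) (i j : 'I_N) : R :=
  match (insub (i, j) : option (edge N)) with
  | Some e => X e
  | None => match (insub (j, i) : option (edge N)) with
            | Some e => X e
            | None => 0
            end
  end.

Definition tdens (H : sgraph) (X : edge N -> R) : R :=
  (\sum_(q : {ffun 'I_(sg_order H) -> 'I_N} | injectiveb q)
      \prod_(e in sg_edges H) Xadj X (q (sval e).1) (q (sval e).2))
  / (N ^_ (sg_order H))%N%:R.

Definition subgraph_count (l : nat) (H : 'I_l -> sgraph) (beta : 'I_l -> R)
    (X : edge N -> R) : R :=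
  (N * (N - 1))%N%:R * \sum_(i < l) beta i * tdens (H i) X.

Definition Cbeta (l : nat) (H : 'I_l -> sgraph) (beta : 'I_l -> R) : R :=
  Num.max (12 * \sum_(i < l) `|beta i| * (#|sg_edges (H i)| ^ 2)%N%:R) 2.

Definition upd (X : edge N -> R) (e : edge N) (a : R) : edge N -> R :=
  fun e' => if e' == e then a else X e'.

Definition pder (f : (edge N -> R) -> R) (e : edge N) (X : edge N -> R) : R :=
  (f (upd X e 1) - f (upd X e 0)) / 2.

Definition tanhR (x : R) : R :=
  (expR x - expR (- x)) / (expR x + expR (- x)).

Definition cube : set (edge N -> R) := [set X | forall e, 0 <= X e <= 1].

Definition l1 (X : edge N -> R) : R := \sum_(e : edge N) `|X e|.

Definition Xset (f : (edge N -> R) -> R) (C : R) : set (edge N -> R) :=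
  [set X | cube X /\
     l1 (fun e => X e - (1 + tanhR (pder f e X)) / 2)
       <= 5000 * C ^+ 2 * (nedges%:R `^ (15 / 16))].

Definition graph := {ffun edge N -> bool}.
Definition emb (G : graph) : edge N -> R := fun e => (G e)%:R.

Definition ergm (f : (edge N -> R) -> R) (G : graph) : R :=
  expR (f (emb G)) / \sum_(G' : graph) expR (f (emb G')).

Definition indep_pmf (p : edge N -> R) (G : graph) : R :=
  \prod_(e : edge N) (if G e then p e else 1 - p e).

(* measurable structure on R^n: sigma-algebra generated by coordinate maps
   (= the Borel sigma-algebra of R^n) *)
Definition coord_sets : set (set (edge N -> R)) :=
  [set S | exists (e : edge N) (A : set R),
             measurable A /\ S = (fun X => X e) @^-1` A].

Definition Rn := g_sigma_algebraType coord_sets.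

(* distribution of G(N,rho): Pr[G(N,rho)=G] = int Pr[G(N,p)=G] drho(p),
   rho a probability measure carried by the cube [0,1]^n *)
Definition GNrho_pmf (rho : probability Rn R) (G : graph) : \bar R :=
  (\int[rho]_(p in (cube : set Rn)) (indep_pmf p G)%:E)%E.

(* G (given by its pmf Gpmf on graphs) is a (rho,delta)-mixture: there is a
   coupling pi of G(N,rho) and G with E||G(N,rho) - G||_1 <= delta n.
   (Couplings of two distributions on the finite set of graphs are exactly
   the nonnegative functions on pairs with the two prescribed marginals.) *)
Definition is_mixture (rho : probability Rn R) (Gpmf : graph -> R) (delta : R)
    : Prop :=
  exists pi : graph * graph -> R,
    [/\ forall x, 0 <= pi x,
        forall G1, ((\sum_(G2 : graph) pi (G1, G2))%:E = GNrho_pmf rho G1)%E,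
        forall G2, \sum_(G1 : graph) pi (G1, G2) = Gpmf G2 &
        \sum_(x : graph * graph) pi x * l1 (fun e => emb x.1 e - emb x.2 e)
          <= delta * nedges%:R].

End Defs.

(* Main.v *)
Require Import Defs.
From HB Require Import structures.
From mathcomp Require Import all_boot all_order all_algebra fingroup perm.
From mathcomp Require Import all_classical all_reals all_analysis.
From mathcomp Require Import measurable_realfun ring lra.
Import Order.TTheory GRing.Theory Num.Theory.
Import numFieldNormedType.Exports.
Local Open Scope classical_set_scope.
Local Open Scope ring_scope.
Set Implicit Arguments. Unset Strict Implicit. Unset Printing Implicit Defensive.

(* The derivative [g_e = 2 pder f e] is an average, over maps [q] of the vertices of the
   [H_i] into [N], of products that only involve edges meeting the image of [q]. Replacing
   this average by an empirical one over [O(n^(1/4))] well-chosen maps gives an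
   approximation [ghat] of [g], close in expected l1-norm under the exponential random
   graph [G], which depends on [G] only through a set [S] of [O(n^(3/4))] edges. Given the
   edges in [S], each remaining edge has, conditionally on all the others, a probability
   close to the constant [(1 + tanh (ghat_e / 2)) / 2]; hence it can be resampled
   independently with that probability at small cost in Hamming distance, and [rho] is the
   law of the resulting vector [p] of edge probabilities. Finally [g p] is the mean of [g]
   under the product measure of parameter [p], [g] is Lipschitz for the Hamming distance
   and this product measure is coupled to [G], so [g p] is close to [ghat], which is the
   fixed point equation. *)

(** * The logistic function in the form (1 + tanh x) / 2 *)

Section Logistic.
Variable R : realType.
Implicit Types x y : R.

Lemma half_tanhE x : (1 + tanhR x) / 2 = expR x / (expR x + expR (- x)).
Proof.
rewrite /tanhR; have := expR_gt0 x; have := expR_gt0 (- x).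
set a := expR x; set b := expR (- x) => b0 a0.
by field; rewrite gt_eqF ?addr_gt0.
Qed.

Lemma half_tanh_ge0 x : 0 <= (1 + tanhR x) / 2.
Proof. by rewrite half_tanhE divr_ge0 ?addr_ge0 ?expR_ge0. Qed.

Lemma half_tanh_le1 x : (1 + tanhR x) / 2 <= 1.
Proof.
rewrite half_tanhE ler_pdivrMr ?addr_gt0 ?expR_gt0// mul1r lerDl.
exact: expR_ge0.
Qed.

(** For [y <= x] the difference is at most 1 - exp (-2 (x - y)), hence at most 2 (x - y). The
    optimal constant is 1/2, but 2 already cancels against the halved arguments to which the bound
    is applied. *)
Lemma half_tanh_lipschitz x y :
  `|(1 + tanhR x) / 2 - (1 + tanhR y) / 2| <= 2 * `|x - y|.
Proof.
wlog le_yx : x y / y <= x => [hw|].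
  by have [/hw//|/ltW /hw] := leP y x; rewrite distrC (distrC y).
rewrite (ger0_norm (_ : 0 <= x - y)) ?subr_ge0//.
have := expR_ge1Dx (- (2 * (x - y))).
have -> : expR (- (2 * (x - y))) = (expR (- x) * expR y) ^+ 2.
  by rewrite -expRD -expRM_natl; congr expR; ring.
have le1 : expR (- x) * expR y <= 1 by rewrite -expRD -expR0 ler_expR; lra.
rewrite !half_tanhE.
have xx : expR x * expR (- x) = 1 by rewrite -expRD subrr expR0.
have yy : expR y * expR (- y) = 1 by rewrite -expRD subrr expR0.
move: xx yy le1 (expR_gt0 x) (expR_gt0 y) (expR_gt0 (- x)) (expR_gt0 (- y)).
set a := expR x; set a' := expR (- x); set b := expR y; set b' := expR (- y).
move=> xx yy le1 a0 b0 a'0 b'0 led.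
have -> : a / (a + a') - b / (b + b') = (a * b' - a' * b) / ((a + a') * (b + b')).
  by field; rewrite !gt_eqF ?addr_gt0.
have ab1 : (a * b') * (a' * b) = 1 by rewrite mulrACA xx mul1r mulrC yy.
have -> : a * b' - a' * b = a * b' * (1 - (a' * b) ^+ 2).
  have -> : a * b' * (1 - (a' * b) ^+ 2) = a * b' - a * b' * (a' * b) * (a' * b) by ring.
  by rewrite ab1 mul1r.
have P0 : 0 < (a + a') * (b + b') by rewrite mulr_gt0 ?addr_gt0.
rewrite ger0_norm; last first.
  apply: divr_ge0; last exact: ltW.
  have t0 : 0 <= a' * b by rewrite mulr_ge0// ltW.
  rewrite mulr_ge0//; first by rewrite mulr_ge0// ltW.
  by rewrite subr_ge0 expr_le1.
rewrite ler_pdivrMr// mulrC.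
apply: (@le_trans _ _ (2 * (x - y) * (a * b'))).
  by apply: ler_wpM2r; [rewrite mulr_ge0 ?ltW | lra].
apply: ler_wpM2l; first lra.
have := mulr_ge0 (ltW a0) (ltW b0); have := mulr_ge0 (ltW a'0) (ltW b0).
have := mulr_ge0 (ltW a'0) (ltW b'0); nra.
Qed.

End Logistic.

(** * Derandomised sampling: Maurey's empirical method *)

Section Maurey.
Variables (R : realFieldType) (Z V : finType).
Variables (w : Z -> R) (F : Z -> V -> R) (mu : V -> R) (cost : Z -> R) (M b : R).
Hypothesis M0 : 0 < M.
Hypothesis F01 : forall z v, `|F z v| <= 1.
Hypothesis mu0 : forall v, 0 <= mu v.
Hypothesis wM : \sum_z `|w z| <= M.
Hypothesis wcost : \sum_z `|w z| * cost z <= M * b.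
Let g v := \sum_z w z * F z v.

(** Draw [z] with probability [|w z| / M], and nothing with the remaining probability: the drawn
    vector [M * sg (w z) * F z] has mean [g] and square at most [M ^+ 2], so the new squared error
    plus the cost is at most [B] on average. Some outcome does no worse; the first alternative is
    the empty draw. *)
Lemma maurey_step (r : V -> R) :
  let B := \sum_v mu v * r v ^+ 2 + M ^+ 2 * \sum_v mu v + b in
  \sum_v mu v * (r v + g v) ^+ 2 <= B \/
  exists z, \sum_v mu v * (r v + g v - M * Num.sg (w z) * F z v) ^+ 2 + cost z <= B.
Proof.
move=> B; set P0 := \sum_v _.
pose P z := \sum_v mu v * (r v + g v - M * Num.sg (w z) * F z v) ^+ 2 + cost z.
have [|P0B] := leP P0 B; first by left.
have [|nP] := pselect (exists z, P z <= B); first by right.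
have PB z : B < P z by rewrite ltNge; apply/negP => h; apply: nP; exists z.
(* The average over the draw, multiplied by [M]. The cross term is exact because [w z] is
   [|w z| * sg (w z)]; the negative term in [g v ^+ 2] is dropped. *)
have avg : \sum_z `|w z| * P z + (M - \sum_z `|w z|) * P0 <= M * B.
  rewrite /P; under eq_bigr do rewrite mulrDr mulr_sumr.
  rewrite big_split /= exchange_big/= /P0 mulr_sumr addrAC -big_split/= /B mulrDr.
  apply: lerD wcost; rewrite mulrDr !mulr_sumr -big_split/=.
  apply: ler_sum => v _.
  set s := r v + g v.
  have h : \sum_z `|w z| * (mu v * (s - M * Num.sg (w z) * F z v) ^+ 2) <=
      mu v * ((\sum_z `|w z|) * s ^+ 2 - 2 * M * s * g v + M ^+ 2 * \sum_z `|w z|).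
    rewrite /g mulr_suml !mulr_sumr -sumrN -!big_split/= mulr_sumr.
    apply: ler_sum => z _; rewrite mulrCA; apply: ler_wpM2l => //.
    have wE : w z = `|w z| * Num.sg (w z) by rewrite mulrC -numEsg.
    have sg2 : Num.sg (w z) ^+ 2 <= 1 by rewrite sqr_sg; case: (w z != 0); rewrite ?lexx ?ler01.
    have F2 : F z v ^+ 2 <= 1 by rewrite -real_normK ?num_real// expr_le1.
    have := congr1 (fun u => 2 * M * s * (u * F z v)) wE.
    have : `|w z| * (M ^+ 2 * (Num.sg (w z) ^+ 2 * F z v ^+ 2)) <= `|w z| * (M ^+ 2 * 1).
      apply: ler_wpM2l => //; apply: ler_wpM2l; first exact: sqr_ge0.
      by apply: mulr_ile1 => //; exact: sqr_ge0.
    set c := `|w z|; set t := Num.sg _; set f := F z v; rewrite /=; lra.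
  have hs : mu v * ((\sum_z `|w z|) * s ^+ 2 - 2 * M * s * g v + M ^+ 2 * \sum_z `|w z|)
     + (M - \sum_z `|w z|) * (mu v * s ^+ 2) <=
     M * (mu v * r v ^+ 2) + M * (M ^+ 2 * mu v).
    have : mu v * (M ^+ 2 * \sum_z `|w z|) <= mu v * (M ^+ 2 * M).
      exact: (ler_wpM2l (mu0 v) (ler_wpM2l (sqr_ge0 M) wM)).
    have := mulr_ge0 (ltW M0) (mulr_ge0 (mu0 v) (sqr_ge0 (g v))).
    rewrite /s; lra.
  exact: le_trans (lerD h (lexx _)) hs.
(* If every outcome exceeded [B], the bound on the average would force all weights, and then [M], to
   vanish. *)
have sum0 : \sum_z `|w z| * (P z - B) + (M - \sum_z `|w z|) * (P0 - B) <= 0.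
  under eq_bigr do rewrite mulrBr.
  rewrite sumrB -mulr_suml; lra.
have s1 : 0 <= \sum_z `|w z| * (P z - B).
  by apply: sumr_ge0 => z _; rewrite mulr_ge0// subr_ge0 ltW.
have s2 : 0 <= (M - \sum_z `|w z|) * (P0 - B).
  by apply: mulr_ge0; [rewrite subr_ge0 | rewrite subr_ge0 ltW].
have MW : M = \sum_z `|w z|.
  apply/eqP; rewrite -subr_eq0.
  have : (M - \sum_z `|w z|) * (P0 - B) == 0 by rewrite eq_le s2 andbT; lra.
  by rewrite mulf_eq0 [P0 - B == 0]subr_eq0 (gt_eqF P0B) orbF.
have /eqP : \sum_z `|w z| * (P z - B) = 0 by apply/eqP; rewrite eq_le s1 andbT; lra.
rewrite psumr_eq0; last by move=> z _; rewrite mulr_ge0// subr_ge0 ltW.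
move=> /allP w0; have : M = 0.
  rewrite MW big1// => z _; apply/eqP.
  by have := w0 z (mem_index_enum z); rewrite /= mulf_eq0 subr_eq0 (gt_eqF (PB z)) orbF.
by move=> M00; move: M0; rewrite M00 ltxx.
Qed.

(** Greedy iteration of [maurey_step] on the accumulated error. Empty draws are allowed, so [s] may
    have fewer than [k] terms. *)
Lemma maurey (k : nat) : exists s : seq Z,
  \sum_v mu v * (k%:R * g v - M * \sum_(z <- s) Num.sg (w z) * F z v) ^+ 2
    + \sum_(z <- s) cost z <= k%:R * (M ^+ 2 * \sum_v mu v + b).
Proof.
elim: k => [|k [s IH]].
  exists [::]; rewrite big_nil mul0r addr0 big1// => v _.
  by rewrite big_nil mul0r mulr0 subr0 expr0n/= mulr0.
pose r v := k%:R * g v - M * \sum_(z <- s) Num.sg (w z) * F z v.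
have := maurey_step r; cbv zeta; case=> [h|[z h]].
  exists s; under eq_bigr => v _.
    have -> : k.+1%:R * g v - M * \sum_(z <- s) Num.sg (w z) * F z v = r v + g v.
      by rewrite /r -natr1; ring.
    over.
  rewrite -natr1; move: IH; rewrite -/r; lra.
exists (z :: s); under eq_bigr => v _.
  have -> : k.+1%:R * g v - M * \sum_(z <- z :: s) Num.sg (w z) * F z v =
     r v + g v - M * Num.sg (w z) * F z v.
    by rewrite /r -natr1 big_cons; ring.
  over.
rewrite -natr1 big_cons; move: IH; rewrite -/r; lra.
Qed.

End Maurey.

(* From l2 to l1 by AM-GM, [2 |x| <= x^2 / t + t] with [t = M j]; the cost is rescaled by
   [la] so as to weigh as much as the variance, which loses only a factor 2. *)
Lemma maurey_l1 (R : realFieldType) (Z V : finType)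
    (w : Z -> R) (F : Z -> V -> R) (mu : V -> R) (cost : Z -> R) (M b : R) (j : nat) :
  0 < M -> 0 < b -> (0 < j)%N -> (forall z v, `|F z v| <= 1) ->
  (forall v, 0 <= mu v) -> 0 < \sum_v mu v -> (forall z, 0 <= cost z) ->
  \sum_z `|w z| <= M -> \sum_z `|w z| * cost z <= M * b ->
  exists s : seq Z,
    \sum_v mu v * `|\sum_z w z * F z v
        - M / j%:R ^+ 2 * \sum_(z <- s) Num.sg (w z) * F z v|
      <= 3 / 2 * M * (\sum_v mu v) / j%:R /\
    \sum_(z <- s) cost z <= 2 * j%:R ^+ 2 * b.
Proof.
move=> M0 b0 j0 F1 mu0; set m := \sum_v mu v => m0 c0 wM wc.
have J0 : 0 < j%:R :> R by rewrite ltr0n.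
pose la := M ^+ 2 * m / b.
have la0 : 0 < la by rewrite divr_gt0// mulr_gt0// exprn_gt0.
have lab : la * b = M ^+ 2 * m by rewrite /la divfK// gt_eqF.
have [|s hs] := @maurey R Z V w F mu (fun z => la * cost z) M (la * b) M0 F1 mu0 wM _ (j ^ 2).
  under eq_bigr do rewrite mulrCA.
  by rewrite -mulr_sumr mulrCA ler_pM2l.
exists s; move: hs; rewrite -/m -mulr_sumr natrX lab.
set J : R := j%:R in J0 *; set Q := \sum_v _; set S := \sum_(z <- s) _ => hs.
have Q0 : 0 <= Q by apply: sumr_ge0 => v _; rewrite mulr_ge0// sqr_ge0.
have S0 : 0 <= S by exact: sumr_ge0.
split; last first.
  rewrite -(ler_pM2l la0); apply: le_trans (_ : J ^+ 2 * (2 * (la * b)) <= _); last by lra.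
  rewrite lab; lra.
have MJ : 0 < M * J by rewrite mulr_gt0.
apply: (@le_trans _ _ (\sum_v (mu v * (J ^+ 2 * (\sum_z w z * F z v)
    - M * (\sum_(z <- s) Num.sg (w z) * F z v)) ^+ 2 / (2 * M * J ^+ 3)
    + mu v * (M / (2 * J))))).
  apply: ler_sum => v _; set g := \sum_z _; set h := \sum_(z <- s) _.
  rewrite -[mu v * _ / _]mulrA -mulrDr; apply: ler_wpM2l => //.
  have -> : g - M / J ^+ 2 * h = (J ^+ 2 * g - M * h) / J ^+ 2.
    by field; rewrite gt_eqF.
  set d := J ^+ 2 * g - M * h.
  rewrite normrM (@ger0_norm _ (J ^+ 2)^-1) ?invr_ge0 ?sqr_ge0//.
  rewrite ler_pdivrMr ?exprn_gt0//.
  have -> : (d ^+ 2 / (2 * M * J ^+ 3) + M / (2 * J)) * J ^+ 2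
     = (d ^+ 2 + (M * J) ^+ 2) / (2 * (M * J)).
    by field; rewrite !gt_eqF.
  rewrite ler_pdivlMr ?mulr_gt0// -(real_normK (num_real d)).
  have := sqr_ge0 (`|d| - M * J); lra.
rewrite big_split/= -!mulr_suml -/m -/Q.
rewrite -(ler_pM2r (_ : 0 < 2 * M * J ^+ 3)); last by rewrite !mulr_gt0// exprn_gt0.
have -> : (Q / (2 * M * J ^+ 3) + m * (M / (2 * J))) * (2 * M * J ^+ 3)
   = Q + M ^+ 2 * m * J ^+ 2 by field; rewrite !gt_eqF.
have -> : 3 / 2 * M * m / J * (2 * M * J ^+ 3) = 3 * (M ^+ 2 * m * J ^+ 2).
  by field; rewrite !gt_eqF.
have := mulr_ge0 (ltW la0) S0; lra.
Qed.

(** * Edge flips, product measures and couplings of random graphs *)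

Section Resampling.
Variables (R : realType) (N : nat).
Implicit Types (G X Y : graph N) (e : edge N) (P : edge N -> R).

Definition flip e G : graph N := [ffun e' => (e' == e) (+) G e'].

Lemma flipK e : involutive (flip e).
Proof. by move=> G; apply/ffunP => e'; rewrite !ffunE addbA addbb. Qed.

Lemma flip_id e G : flip e G e = ~~ G e.
Proof. by rewrite ffunE eqxx. Qed.

Lemma flip_neq e e' G : e' != e -> flip e G e' = G e'.
Proof. by rewrite ffunE => /negbTE->. Qed.

Lemma sum_flip e (h : graph N -> R) : \sum_G h (flip e G) = \sum_G h G.
Proof. by rewrite [RHS](reindex_inj (inv_inj (flipK e))). Qed.

Lemma sum_flip_half e (h : graph N -> R) : \sum_G h G = (\sum_G (h G + h (flip e G))) / 2.
Proof. by rewrite big_split/= sum_flip; lra. Qed.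

Lemma indep_pmf_ge0 P Y : (forall e, 0 <= P e <= 1) -> 0 <= indep_pmf P Y.
Proof.
move=> P01; apply: prodr_ge0 => e _; have /andP[? ?] := P01 e.
by case: (Y e) => //; rewrite subr_ge0.
Qed.

Lemma indep_pmf_sum1 P : \sum_Y indep_pmf P Y = 1.
Proof.
rewrite /indep_pmf -(bigA_distr_bigA (fun e (x : bool) => if x then P e else 1 - P e)).
by rewrite big1// => e _; rewrite big_bool/=; lra.
Qed.

Lemma indep_pmf_emb G Y : indep_pmf (emb R G) Y = (Y == G)%:R.
Proof.
rewrite /indep_pmf /emb; have [->|neq] := eqVneq Y G.
  by rewrite big1// => e _; case: (G e) => //=; rewrite subr0.
have [e YG] : exists e, Y e != G e.
  apply/existsP; apply: contraR neq => /existsPn h; apply/eqP/ffunP => e.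
  by apply/eqP; move: (h e); rewrite negbK.
by rewrite (bigD1 e)//=; move: YG; case: (Y e); case: (G e) => //= _; rewrite ?subrr mul0r.
Qed.

Lemma indep_pmf_eq P P' Y : P =1 P' -> indep_pmf P Y = indep_pmf P' Y.
Proof. by move=> PP'; apply: eq_bigr => e _; rewrite PP'. Qed.

(** Law of the edges other than [e], seen as a function of the whole of [Y]; its total mass is
    therefore 2. *)
Definition indep_rest e P Y : R := \prod_(e' | e' != e) (if Y e' then P e' else 1 - P e').

Lemma indep_pmfE e P Y :
  indep_pmf P Y = (if Y e then P e else 1 - P e) * indep_rest e P Y.
Proof. by rewrite /indep_pmf (bigD1 e). Qed.

Lemma indep_rest_flip e P Y : indep_rest e P (flip e Y) = indep_rest e P Y.
Proof. by apply: eq_bigr => e' ne; rewrite flip_neq. Qed.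

Lemma indep_rest_eq e P P' Y : (forall e', e' != e -> P e' = P' e') ->
  indep_rest e P Y = indep_rest e P' Y.
Proof. by move=> PP'; apply: eq_bigr => e' ne; rewrite PP'. Qed.

Lemma indep_rest_ge0 e P Y : (forall e, 0 <= P e <= 1) -> 0 <= indep_rest e P Y.
Proof.
move=> P01; apply: prodr_ge0 => e' _; have /andP[? ?] := P01 e'.
by case: (Y e') => //; rewrite subr_ge0.
Qed.

Lemma indep_pmf_flip e P Y : indep_pmf P Y + indep_pmf P (flip e Y) = indep_rest e P Y.
Proof.
rewrite !(indep_pmfE e) indep_rest_flip flip_id -mulrDl.
by case: (Y e) => /=; rewrite ?subrK ?subrKC mul1r.
Qed.

Lemma indep_rest_sum e P : \sum_Y indep_rest e P Y = 2.
Proof.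
under eq_bigr do rewrite -indep_pmf_flip.
by rewrite big_split/= sum_flip indep_pmf_sum1; lra.
Qed.

(** Independence factorises the mean of a square-free monomial: the sum over [Y] is a product over
    edges of two-term sums. *)
Lemma indep_pmf_prod P (A : {set edge N}) :
  \sum_Y indep_pmf P Y * \prod_(e in A) emb R Y e = \prod_(e in A) P e.
Proof.
transitivity (\sum_(Y : graph N) \prod_e
    ((if Y e then P e else 1 - P e) * (if e \in A then (Y e)%:R else 1))).
  by apply: eq_bigr => Y _; rewrite big_split/= -big_mkcond.
rewrite -(bigA_distr_bigA (fun e (x : bool) =>
  (if x then P e else 1 - P e) * (if e \in A then x%:R else 1))).
rewrite [RHS]big_mkcond/=; apply: eq_bigr => e _; rewrite big_bool/=.
by case: ifP => _; rewrite ?mulr1 ?mulr0 ?addr0// subrKC.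
Qed.

Definition hamming X Y : R := l1 (fun e => emb R X e - emb R Y e).

Lemma hamming_flip e X Y : hamming (flip e X) Y <= hamming X Y + 1.
Proof.
have -> : 1 = \sum_e' (e' == e)%:R :> R.
  by rewrite (bigD1 e)//= eqxx big1 ?addr0// => e' /negbTE->.
rewrite /hamming /l1 -big_split/=; apply: ler_sum => e' _; rewrite /emb ffunE.
have [->|_] /= := eqVneq e' e; last by rewrite addr0.
by case: (X e); case: (Y e); rewrite /= ?subrr ?subr0 ?sub0r ?normrN ?normr0 ?normr1; lra.
Qed.

(** Counterpart of [is_mixture] whose first marginal is a function instead of an integral, so that
    couplings can be built edge by edge. *)
Definition coupled (mu nu : graph N -> R) (d : R) : Prop :=
  exists pi : graph N * graph N -> R,
    [/\ forall x, 0 <= pi x,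
        forall X, \sum_Y pi (X, Y) = mu X,
        forall Y, \sum_X pi (X, Y) = nu Y &
        \sum_(x : graph N * graph N) pi x * hamming x.1 x.2 <= d].

Lemma coupled_refl mu : (forall X, 0 <= mu X) -> coupled mu mu 0.
Proof.
move=> mu0; exists (fun x => mu x.1 * (x.1 == x.2)%:R); split=> [x|X|Y|].
- by rewrite mulr_ge0.
- rewrite (bigD1 X)//= eqxx mulr1 big1 ?addr0// => Y.
  by rewrite eq_sym => /negbTE->; rewrite mulr0.
- rewrite (bigD1 Y)//= eqxx mulr1 big1 ?addr0// => X.
  by move=> /negbTE->; rewrite mulr0.
- rewrite big1// => -[X Y] _ /=; have [->|_] := eqVneq X Y; last by rewrite mulr0 mul0r.
  by rewrite /hamming /l1 big1 ?mulr0// => e _; rewrite subrr normr0.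
Qed.

(* Keep [X] with probability [min (mu X) (mu' X) / mu X] (read as 0 if [mu X = 0]), and
   flip its edge [e] otherwise. *)
Lemma coupled_step e mu mu' nu d :
  (forall X, 0 <= mu X) -> (forall X, 0 <= mu' X) ->
  (forall X, mu' X + mu' (flip e X) = mu X + mu (flip e X)) ->
  coupled mu nu d -> coupled mu' nu (d + \sum_X `|mu' X - mu X|).
Proof.
move=> mu0 mu'0 mu_flip [pi [pi0 pi1 pi2 pid]].
pose k X := Num.min (mu X) (mu' X) / mu X.
have k0 X : 0 <= k X by rewrite divr_ge0// le_min mu0 mu'0.
have k1 X : k X <= 1.
  have [mu_eq0|mu_neq0] := eqVneq (mu X) 0; first by rewrite /k mu_eq0 invr0 mulr0.
  by rewrite ler_pdivrMr ?lt_def ?mu_neq0 ?mu0// mul1r ge_min lexx.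
have muk X : mu X * k X = Num.min (mu X) (mu' X).
  have [mu_eq0|mu_neq0] := eqVneq (mu X) 0; last by rewrite /k mulrC divfK.
  by rewrite mu_eq0 mul0r min_l.
exists (fun x => pi x * k x.1 + pi (flip e x.1, x.2) * (1 - k (flip e x.1))); split=> /=.
- by move=> x; apply: addr_ge0; apply: mulr_ge0; rewrite ?subr_ge0.
(* Both measures give the pair [X], [flip e X] the same mass, so what leaves [flip e X] is exactly
   what [X] lacks. *)
- move=> X; rewrite big_split/= -!mulr_suml !pi1 mulrBr !muk mulr1.
  have := mu_flip X; rewrite !minElt; case: (ltP (mu X)); case: (ltP (mu (flip e X))); lra.
- move=> Y; rewrite big_split/= (sum_flip e (fun X => pi (X, Y) * (1 - k X))) -big_split/=.
  by rewrite -pi2; apply: eq_bigr => X _; rewrite -mulrDr subrKC mulr1.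
- have pairE (h : graph N * graph N -> R) : \sum_x h x = \sum_X \sum_Y h (X, Y).
    by rewrite pair_bigA; apply: eq_bigr => -[].
  rewrite pairE exchange_big/=.
  have stepY Y : \sum_X (pi (X, Y) * k X + pi (flip e X, Y) * (1 - k (flip e X))) * hamming X Y
      <= \sum_X (pi (X, Y) * hamming X Y + pi (X, Y) * (1 - k X)).
    under eq_bigr do rewrite mulrDl.
    rewrite big_split/=.
    rewrite -(sum_flip e (fun X => pi (flip e X, Y) * (1 - k (flip e X)) * hamming X Y)).
    rewrite -big_split/=; apply: ler_sum => X _; rewrite flipK.
    (* Only the moved mass can increase the distance, and by at most 1. *)
    have h := hamming_flip e X Y.
    have : pi (X, Y) * (1 - k X) * hamming (flip e X) Y
        <= pi (X, Y) * (1 - k X) * (hamming X Y + 1).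
      by apply: ler_wpM2l => //; rewrite mulr_ge0// subr_ge0.
    lra.
  apply: le_trans (ler_sum _ (fun Y _ => stepY Y)) _.
  rewrite exchange_big/=; under eq_bigr do rewrite big_split/= -mulr_suml pi1.
  rewrite big_split/=; move: pid; rewrite pairE => pid.
  apply: lerD => //; apply: ler_sum => X _; rewrite mulrBr muk mulr1 minElt.
  have := ler_norm (- (mu' X - mu X)); have := normr_ge0 (mu' X - mu X).
  by rewrite normrN; case: ltP; lra.
Qed.

(** * Replacing edges one at a time by independent ones *)

Section Hybrid.
Variables (nu : graph N -> R) (m p : edge N -> graph N -> R).
Hypothesis nu0 : forall G, 0 <= nu G.
Hypothesis m_flip : forall e G, m e (flip e G) = m e G.
(** Under [nu], [m e] is the conditional probability of the edge [e] given all the others. *)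
Hypothesis nu_m : forall e G,
  nu G * (emb R G e - m e G) + nu (flip e G) * (emb R (flip e G) e - m e G) = 0.
Hypothesis p01 : forall e G, 0 <= p e G <= 1.

(** A 0/1 parameter makes an edge deterministic, so the product measure of parameter [hybrid r G]
    keeps the edges of [G] outside [r] and resamples those in [r]. *)
Definition hybrid (r : seq (edge N)) G e : R := if e \in r then p e G else emb R G e.
Definition mix (r : seq (edge N)) Y : R := \sum_G nu G * indep_pmf (hybrid r G) Y.

Lemma emb01 G e : 0 <= emb R G e <= 1.
Proof. by rewrite /emb; case: (G e); rewrite !lexx ler01. Qed.

Lemma hybrid01 r G e : 0 <= hybrid r G e <= 1.
Proof. by rewrite /hybrid; case: ifP => _; [exact: p01 | exact: emb01]. Qed.

Lemma mix_ge0 r Y : 0 <= mix r Y.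
Proof.
apply: sumr_ge0 => G _; rewrite mulr_ge0//.
by apply: indep_pmf_ge0 => e; exact: hybrid01.
Qed.

Lemma mix_nil Y : mix [::] Y = nu Y.
Proof.
rewrite /mix (bigD1 Y)//= big1 => [|G GY].
  by rewrite (indep_pmf_eq (P' := emb R Y))// indep_pmf_emb eqxx mulr1 addr0.
rewrite (indep_pmf_eq (P' := emb R G))// indep_pmf_emb.
by rewrite eq_sym (negbTE GY) mulr0.
Qed.

(** [psi] and [m e] agree on [G] and [flip e G], so each such pair contributes zero by [nu_m]. *)
Lemma cond_exp e (psi : graph N -> R) : (forall G, psi (flip e G) = psi G) ->
  \sum_G nu G * psi G * (emb R G e - m e G) = 0.
Proof.
move=> psi_flip; rewrite (sum_flip_half e) big1 ?mul0r// => G _.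
by rewrite psi_flip m_flip !(mulrAC _ (psi G)) -mulrDl nu_m mul0r.
Qed.

Lemma hybrid_cons e r G e' : e' != e -> hybrid (e :: r) G e' = hybrid r G e'.
Proof. by rewrite /hybrid inE => /negbTE->. Qed.

(** Resampling [e] leaves the law of the other edges unchanged, as [coupled_step] requires. *)
Lemma mix_flip e r Y : mix (e :: r) Y + mix (e :: r) (flip e Y) = mix r Y + mix r (flip e Y).
Proof.
rewrite /mix -!big_split/=; apply: eq_bigr => G _.
rewrite -!mulrDr !indep_pmf_flip; congr (_ * _).
by apply: indep_rest_eq => e' ne; rewrite hybrid_cons.
Qed.

(** Resampling [e] replaces its indicator by [p e]. The factor [indep_rest] does not involve the
    value of [e] in [G], so [cond_exp] averages the indicator to [m e]; the factor 2 is the mass of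
    [indep_rest]. *)
Lemma mix_step e r : e \notin r ->
  (forall e' G, e' \in e :: r -> p e' (flip e G) = p e' G) ->
  \sum_Y `|mix (e :: r) Y - mix r Y| <= 2 * \sum_G nu G * `|p e G - m e G|.
Proof.
move=> er p_flip.
have rest_flip Y G : indep_rest e (hybrid r (flip e G)) Y = indep_rest e (hybrid r G) Y.
  apply: indep_rest_eq => e' ne; rewrite /hybrid /emb flip_neq//.
  by case: ifP => // e'r; rewrite p_flip// inE e'r orbT.
have diffE Y : mix (e :: r) Y - mix r Y =
    \sum_G nu G * indep_rest e (hybrid r G) Y * ((-1) ^+ (~~ Y e) * (p e G - m e G)).
  (* Subtracting a null term turns [m e] back into the indicator of [e]. *)
  set T := RHS; rewrite (_ : T = T - (-1) ^+ (~~ Y e) *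
    \sum_G nu G * indep_rest e (hybrid r G) Y * (emb R G e - m e G)); last first.
    by rewrite (cond_exp (rest_flip Y)) mulr0 subr0.
  rewrite /T /mix mulr_sumr -!sumrB; apply: eq_bigr => G _.
  rewrite !(indep_pmfE e).
  rewrite (indep_rest_eq (P' := hybrid r G) (P := hybrid (e :: r) G)); last first.
    by move=> e' ne; rewrite hybrid_cons.
  rewrite /hybrid inE eqxx (negbTE er)/=.
  by case: (Y e); rewrite ?expr0 ?expr1; ring.
apply: (@le_trans _ _ (\sum_Y \sum_G nu G * `|p e G - m e G| * indep_rest e (hybrid r G) Y)).
  apply: ler_sum => Y _; rewrite diffE; apply: le_trans (ler_norm_sum _ _ _) _.
  apply: ler_sum => G _; rewrite !normrM normrX normrN1 expr1n mul1r.
  rewrite (ger0_norm (nu0 _)) (ger0_norm (indep_rest_ge0 _ _ (hybrid01 _ _))).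
  by rewrite mulrAC.
rewrite exchange_big/= mulr_sumr; apply: ler_sum => G _.
by rewrite -mulr_sumr indep_rest_sum mulrC.
Qed.

Section Closed.
Variable S : {set edge N}.
Hypothesis p_flip : forall e e' G, e \notin S -> p e' (flip e G) = p e' G.

Let cost e := 2 * \sum_G nu G * `|p e G - m e G|.

(** Flipping an edge outside [S] does not change the parameters, so [mix_step] applies to each edge
    of [r] in turn, starting from the coupling of [nu] with itself. *)
Lemma mix_coupled r : uniq r -> {in r, forall e, e \notin S} ->
  coupled (mix r) nu (\sum_(e <- r) cost e).
Proof.
elim: r => [_ _|e r IH /=/andP[er ur] rS].
  have -> : mix [::] = nu by apply/funext => Y; exact: mix_nil.
  by rewrite big_nil; exact: coupled_refl.
have eS : e \notin S by apply: rS; rewrite inE eqxx.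
have /IH-/(_ ur) {}IH : {in r, forall e, e \notin S}.
  by move=> e' e'r; apply: rS; rewrite inE e'r orbT.
have [pi [? ? ? pid]] := coupled_step (mix_ge0 r) (mix_ge0 (e :: r)) (mix_flip e r) IH.
exists pi; split=> //; apply: le_trans pid _; rewrite big_cons addrC lerD2r.
by apply: mix_step => // e' G _; exact: p_flip.
Qed.

(** Proved directly, since [coupled] does not record that only edges outside [S] move. One
    resampling changes the law by opposite amounts at [Y] and [flip e Y], so only the differences of
    [phi] between these two graphs enter. *)
Lemma mix_lipschitz (phi : graph N -> R) (L : R) r :
  (forall e Y, e \notin S -> `|phi Y - phi (flip e Y)| <= L) ->
  uniq r -> {in r, forall e, e \notin S} ->
  \sum_Y mix r Y * phi Y <= \sum_Y nu Y * phi Y + L * \sum_(e <- r) cost e.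
Proof.
move=> phiL; elim: r => [_ _|e r IH /=/andP[er ur] rS].
  by rewrite big_nil mulr0 addr0; under eq_bigr do rewrite mix_nil.
have eS : e \notin S by apply: rS; rewrite inE eqxx.
have /IH-/(_ ur) {}IH : {in r, forall e, e \notin S}.
  by move=> e' e'r; apply: rS; rewrite inE e'r orbT.
rewrite big_cons mulrDr addrCA.
have L0 : 0 <= L by apply: le_trans (phiL e (finfun (fun=> true)) eS).
have sumD : \sum_Y (mix (e :: r) Y - mix r Y) * phi Y =
    \sum_Y mix (e :: r) Y * phi Y - \sum_Y mix r Y * phi Y.
  by rewrite -sumrB; apply: eq_bigr => Y _; rewrite mulrBl.
suff : \sum_Y (mix (e :: r) Y - mix r Y) * phi Y <= L * cost e by rewrite sumD; lra.
rewrite (sum_flip_half e).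
apply: (@le_trans _ _ (L * \sum_Y `|mix (e :: r) Y - mix r Y|)); last first.
  by apply: ler_wpM2l => //; apply: mix_step => // e' G _; exact: p_flip.
rewrite ler_pdivrMr// mulr_sumr mulr_suml; apply: ler_sum => Y _.
have -> : mix (e :: r) (flip e Y) - mix r (flip e Y) = - (mix (e :: r) Y - mix r Y).
  by have := mix_flip e r Y; lra.
set D := mix (e :: r) Y - mix r Y.
rewrite mulNr -mulrBr; apply: le_trans (ler_norm _) _; rewrite normrM mulrC.
apply: (@le_trans _ _ (L * `|D|)); first by apply: ler_wpM2r => //; exact: phiL.
have := mulr_ge0 L0 (normr_ge0 D); lra.
Qed.

End Closed.
End Hybrid.
End Resampling.

(** * Edges under injective vertex maps and permutations *)

Section EdgeMaps.
Variables (N : nat) (e0 : edge N).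
Implicit Types (u v : 'I_N) (e c : edge N).

Lemma edge_neq m (b : edge m) : (val b).1 != (val b).2.
Proof. by rewrite -val_eqE/= ltn_eqF// (valP b). Qed.

(* [e0] is a junk value for the diagonal [u = v]. *)
Definition mkedge u v : edge N := odflt (odflt e0 (insub (v, u))) (insub (u, v)).

Lemma mkedgeP u v : u != v -> val (mkedge u v) = (u, v) \/ val (mkedge u v) = (v, u).
Proof.
rewrite /mkedge -val_eqE /= neq_ltn => /orP[uv|vu].
  by left; rewrite (@insubT _ (fun p : 'I_N * 'I_N => (p.1 < p.2)%N) _ (u, v) uv).
right; rewrite [insub (u, v)]insubF/=; last by apply/negbTE; rewrite -leqNgt ltnW.
by rewrite (@insubT _ (fun p : 'I_N * 'I_N => (p.1 < p.2)%N) _ (v, u) vu).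
Qed.

Lemma mkedgeK e : mkedge (val e).1 (val e).2 = e.
Proof. by rewrite /mkedge -surjective_pairing valK. Qed.

Lemma mkedgeC u v : u != v -> mkedge u v = mkedge v u.
Proof.
move=> uv; have vu : v != u by rewrite eq_sym.
apply: val_inj; case: (mkedgeP uv) (valP (mkedge u v)) => ->;
  case: (mkedgeP vu) (valP (mkedge v u)) => -> //= h1 h2.
  by move: (ltn_trans h1 h2); rewrite ltnn.
by move: (ltn_trans h1 h2); rewrite ltnn.
Qed.

Lemma XadjE (R : realType) (X : edge N -> R) u v : u != v -> Xadj X u v = X (mkedge u v).
Proof.
rewrite /Xadj /mkedge -val_eqE /= neq_ltn => /orP[uv|vu].
  by rewrite (@insubT _ (fun p : 'I_N * 'I_N => (p.1 < p.2)%N) _ (u, v) uv).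
rewrite [insub (u, v)]insubF/=; last by apply/negbTE; rewrite -leqNgt ltnW.
by rewrite (@insubT _ (fun p : 'I_N * 'I_N => (p.1 < p.2)%N) _ (v, u) vu).
Qed.

Definition star v : {set edge N} := [set e | (v == (val e).1) || (v == (val e).2)].

(** Every edge at [v] is [mkedge v u] for some [u]; the junk value at [u = v] is counted too, whence
    [N] and not [N - 1]. *)
Lemma card_star v : (#|star v| <= N)%N.
Proof.
apply: (@leq_trans #|[set mkedge v u | u : 'I_N]|); last first.
  by apply: leq_trans (leq_imset_card _ _) _; rewrite card_ord.
apply: subset_leq_card; apply/fintype.subsetP => e; rewrite inE => /orP[]/eqP ->; apply/imsetP.
  by exists (val e).2; rewrite ?mkedgeK.
by exists (val e).1; rewrite // mkedgeC ?mkedgeK// eq_sym edge_neq.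
Qed.

Lemma mkedge_star u v : u != v -> mkedge u v \in star u.
Proof. by move=> uv; rewrite inE; case: (mkedgeP uv) => -> /=; rewrite eqxx ?orbT. Qed.

Section EdgeMap.
Variable m : nat.
Implicit Types (q : {ffun 'I_m -> 'I_N}) (a b : edge m).

Definition emap q b : edge N := mkedge (q (val b).1) (q (val b).2).

Lemma emap_inj q : injective q -> injective (emap q).
Proof.
move=> qI a b; have na : q (val a).1 != q (val a).2 by rewrite (inj_eq qI) edge_neq.
have nb : q (val b).1 != q (val b).2 by rewrite (inj_eq qI) edge_neq.
move=> /(congr1 val); rewrite /emap.
case: (mkedgeP na) => ->; case: (mkedgeP nb) => -> [/qI h1 /qI h2]; apply: val_inj.
- by rewrite [LHS]surjective_pairing [RHS]surjective_pairing h1 h2.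
- by have := valP a; rewrite /= h1 h2 ltnNge ltnW ?(valP b).
- by have := valP a; rewrite /= h1 h2 ltnNge ltnW ?(valP b).
- by rewrite [LHS]surjective_pairing [RHS]surjective_pairing h1 h2.
Qed.

End EdgeMap.

Definition pmap_edge (s : {perm 'I_N}) e : edge N := mkedge (s (val e).1) (s (val e).2).

Lemma pmap_edge_inj s : injective (pmap_edge s).
Proof.
have fs : injective (finfun s) by move=> u v; rewrite !ffunE => /perm_inj.
have E e : pmap_edge s e = emap (finfun s) e by rewrite /pmap_edge /emap !ffunE.
by move=> e c; rewrite !E => /(emap_inj fs).
Qed.

Lemma pmap_mkedge (s : {perm 'I_N}) u v : u != v ->
  pmap_edge s (mkedge u v) = mkedge (s u) (s v).
Proof.
move=> uv; rewrite /pmap_edge; case: (mkedgeP uv) => -> //=.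
by rewrite mkedgeC// (inj_eq perm_inj) eq_sym.
Qed.

(* A permutation carrying the edge [c] to the edge [e] which, off the endpoints of [c],
   displaces a vertex only to an endpoint of [c]. *)
Definition move_edge c e : {perm 'I_N} :=
  let s := tperm (val c).1 (val e).1 in (s * tperm (s (val c).2) (val e).2)%g.

Lemma move_edge1 c e : move_edge c e (val c).1 = (val e).1.
Proof.
have h1 : tperm (val c).1 (val e).1 (val c).2 != (val e).1.
  rewrite -[X in _ != X](tpermL (val c).1 (val e).1) (inj_eq perm_inj) eq_sym.
  exact: edge_neq.
have h2 : (val e).2 != (val e).1 by rewrite eq_sym edge_neq.
by rewrite /move_edge permM tpermL (tpermD h1 h2).
Qed.

Lemma move_edge2 c e : move_edge c e (val c).2 = (val e).2.
Proof. by rewrite /move_edge permM tpermL. Qed.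

Lemma pmap_move_edge c e : pmap_edge (move_edge c e) c = e.
Proof. by rewrite /pmap_edge move_edge1 move_edge2 mkedgeK. Qed.

(** Whatever the target [e], a moved vertex stays within a few vertices known in advance; the set
    [seen] relies on this. *)
Lemma move_edge_off c e u : u != (val c).1 -> u != (val c).2 ->
  move_edge c e u \in [:: u; (val c).1; (val c).2].
Proof.
move=> u1 u2; rewrite /move_edge permM !inE.
set s := tperm (val c).1 (val e).1.
have sc2 : s (val c).2 = (val c).1 \/ s (val c).2 = (val c).2.
  rewrite /s; case: tpermP => [h|->|_ _]; [|by left|by right].
  by have := edge_neq c; rewrite h eqxx.
have su : s u = (val c).1 \/ s u = u.
  by rewrite /s; case: tpermP => [h|->|_ _]; [move: u1; rewrite h eqxx|left|right].
case: tpermP => [/perm_inj uc|_|_ _].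
- by move: u2; rewrite uc eqxx.
- by case: sc2 => ->; rewrite eqxx ?orbT.
- by case: su => ->; rewrite eqxx ?orbT.
Qed.

Definition actf m (s : {perm 'I_N}) (q : {ffun 'I_m -> 'I_N}) : {ffun 'I_m -> 'I_N} :=
  [ffun i => s (q i)].

Lemma actf_inj m s (q : {ffun 'I_m -> 'I_N}) : injectiveb (actf s q) = injectiveb q.
Proof.
apply/injectiveP/injectiveP => qI i j; last by rewrite !ffunE => /perm_inj/qI.
by move=> h; apply: qI; rewrite !ffunE h.
Qed.

Lemma emap_actf m s (q : {ffun 'I_m -> 'I_N}) b : injectiveb q ->
  emap (actf s q) b = pmap_edge s (emap q b).
Proof.
move=> /injectiveP qI; rewrite /emap !ffunE pmap_mkedge//.
by rewrite (inj_eq qI) edge_neq.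
Qed.

(** Group the maps by the image [c] of [a]: composing with [move_edge c e] is a bijection onto the
    maps sending [a] to [e], so all classes contribute equally. A sum over maps constrained by [e]
    thus becomes one over a set of maps independent of [e]. *)
Lemma sum_emap_eq (R : comPzRingType) m (a : edge m) e (F : {ffun 'I_m -> 'I_N} -> R) :
  \sum_(q : {ffun 'I_m -> 'I_N} | injectiveb q) F (actf (move_edge (emap q a) e) q)
  = #|{: edge N}|%:R * \sum_(q : {ffun 'I_m -> 'I_N} | injectiveb q && (emap q a == e)) F q.
Proof.
rewrite (partition_big (fun q => emap q a) xpredT)//=.
rewrite -sum1_card natr_sum mulr_suml; apply: eq_bigr => c _; rewrite mul1r.
set s := move_edge c e.
have sK : cancel (@actf m s) (actf s^-1%g).
  by move=> q; apply/ffunP => i; rewrite !ffunE permK.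
have sK' : cancel (@actf m s^-1%g) (actf s).
  by move=> q; apply/ffunP => i; rewrite !ffunE permKV.
rewrite [RHS](reindex (actf s)); last by exists (actf s^-1%g) => q _.
apply: eq_big => [q|q /andP[_ /eqP->]//].
rewrite actf_inj; case: (boolP (injectiveb q)) => //= qI.
by rewrite emap_actf// -[in RHS](pmap_move_edge c e) (inj_eq (@pmap_edge_inj _)).
Qed.

(** By symmetry, every edge is the image of [a] under equally many injective maps. *)
Lemma sum_emap_eq1 (R : comPzRingType) m (a : edge m) e :
  #|{: edge N}|%:R * \sum_(q : {ffun 'I_m -> 'I_N} | injectiveb q && (emap q a == e)) 1
  = (N ^_ m)%:R :> R.
Proof.
rewrite -(sum_emap_eq a e (fun=> 1)) sumr_const.
by have := card_inj_ffuns 'I_m 'I_N; rewrite !card_ord cardsE => <-.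
Qed.

End EdgeMaps.

Lemma card_edge N : #|{: edge N}| = 'C(N, 2).
Proof.
rewrite card_sig -sum1_card -bin2_sum big_mkord.
rewrite -(pair_big_dep xpredT (fun i j : 'I_N => (i < j)%N) (fun _ _ => 1%N))/=.
rewrite (exchange_big_dep xpredT)//=; apply: eq_bigr => j _.
by rewrite -(big_ord_widen N (fun=> 1%N) (ltnW (ltn_ord j))) sum1_card card_ord.
Qed.

(** * The gradient as a polynomial and as a weighted sum over samples *)

Section GradientPolynomial.
Variables (R : realType) (N : nat) (e0 : edge N) (l : nat).
Variables (H : 'I_l -> sgraph) (beta : 'I_l -> R).
Implicit Types (X : edge N -> R) (e : edge N).

Let ord i := sg_order (H i).
Let scale i : R := (N * (N - 1))%N%:R / (N ^_ ord i)%:R.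

Definition subprod m (A : {set edge m}) a (q : {ffun 'I_m -> 'I_N}) X : R :=
  \prod_(b in A :\ a) X (emap e0 q b).

(** Twice [pder], as an explicit polynomial: each monomial of [f] through [e] loses its factor
    [X e]. *)
Definition grad e X : R :=
  \sum_i \sum_(a in sg_edges (H i))
    \sum_(q : {ffun 'I_(ord i) -> 'I_N} | injectiveb q && (emap e0 q a == e))
      beta i * scale i * subprod (sg_edges (H i)) a q X.

(** By injectivity at most one edge of [A] lands on [e], so the product is affine in the coordinate
    [e]. *)
Lemma prod_upd m (A : {set edge m}) (q : {ffun 'I_m -> 'I_N}) X e : injective q ->
  \prod_(b in A) upd X e 1 (emap e0 q b) - \prod_(b in A) upd X e 0 (emap e0 q b)
  = \sum_(a in A | emap e0 q a == e) subprod A a q X.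
Proof.
move=> qI; have emI : injective (emap e0 q) := emap_inj qI.
have [/existsP[a /andP[aA /eqP qa]]|] := boolP [exists a, (a \in A) && (emap e0 q a == e)].
  have other x b : b \in A :\ a -> upd X e x (emap e0 q b) = X (emap e0 q b).
    by rewrite !inE => /andP[ba _]; rewrite /upd -qa (inj_eq emI) (negbTE ba).
  have updE x : \prod_(b in A) upd X e x (emap e0 q b) = x * subprod A a q X.
    rewrite (big_setD1 a aA)/= {1}/upd qa eqxx; congr (_ * _).
    by apply: eq_bigr => b; exact: other.
  rewrite !updE mul1r mul0r subr0.
  rewrite (big_pred1 a) // => b; rewrite -qa (inj_eq emI).
  by rewrite /=; case: eqVneq => [->|_]; rewrite ?aA ?andbF.
move=> /existsPn none; rewrite [RHS]big1 => [|a /andP[aA qa]]; last first.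
  by have := none a; rewrite aA qa.
apply/eqP; rewrite subr_eq0; apply/eqP; apply: eq_bigr => b bA.
by rewrite /upd; case: eqP => // qb; have := none b; rewrite bA qb eqxx.
Qed.

Lemma tdensE K X : tdens K X =
  (\sum_(q : {ffun 'I_(sg_order K) -> 'I_N} | injectiveb q)
     \prod_(b in sg_edges K) X (emap e0 q b)) / (N ^_ sg_order K)%:R.
Proof.
congr (_ / _); apply: eq_bigr => q /injectiveP qI; apply: eq_bigr => b _.
by rewrite (XadjE e0)// (inj_eq qI) edge_neq.
Qed.

Lemma pder_grad e X : pder (subgraph_count H beta) e X = grad e X / 2.
Proof.
congr (_ / _); rewrite /subgraph_count -mulrBr -sumrB mulr_sumr; apply: eq_bigr => i _.
rewrite !tdensE -mulrBr -mulrBl -sumrB.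
under eq_bigr => q /injectiveP qI do rewrite prod_upd//.
rewrite (exchange_big_dep (mem (sg_edges (H i))))/=; last by move=> q a _ /andP[].
rewrite !mulr_suml !mulr_sumr; apply: eq_bigr => a aA.
rewrite mulr_suml !mulr_sumr; apply: eq_big => [q|q _]; first by rewrite aA.
by rewrite /scale /ord; ring.
Qed.

Definition sample : finType :=
  {i : 'I_l & (edge (ord i) * {ffun 'I_(ord i) -> 'I_N})%type}.

(** The 2 comes from N (N - 1) = 2 n, the factor n being absorbed by [sum_emap_eq]. Triples that are
    not genuine samples get weight 0. *)
Definition weight (z : sample) : R :=
  let: existT i (a, q) := z in
  if (a \in sg_edges (H i)) && injectiveb q then 2 * beta i / (N ^_ ord i)%:R else 0.

Definition feature (z : sample) e X : R :=
  let: existT i (a, q) := z in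
  subprod (sg_edges (H i)) a (actf (move_edge (emap e0 q a) e) q) X.

(** Built from [q] alone, so that one set of O(N) edges determines the features of [z] for all [e]
    at once. *)
Definition seen (z : sample) : {set edge N} :=
  let: existT i (a, q) := z in
  \bigcup_(b in sg_edges (H i)) (star (q (val b).1) :|: star (q (val b).2)).

Definition mk_sample i (a : edge (ord i)) (q : {ffun 'I_(ord i) -> 'I_N}) : sample :=
  existT _ i (a, q).

Lemma sum_sample (h : forall i : 'I_l, edge (ord i) -> {ffun 'I_(ord i) -> 'I_N} -> R)
    (h' : sample -> R) :
  (forall i (a : edge (ord i)) (q : {ffun 'I_(ord i) -> 'I_N}),
    a \in sg_edges (H i) -> injectiveb q -> h' (mk_sample a q) = h i a q) ->
  (forall i (a : edge (ord i)) (q : {ffun 'I_(ord i) -> 'I_N}),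
    ~~ ((a \in sg_edges (H i)) && injectiveb q) -> h' (mk_sample a q) = 0) ->
  \sum_z h' z = \sum_i \sum_(a in sg_edges (H i))
    \sum_(q : {ffun 'I_(ord i) -> 'I_N} | injectiveb q) h i a q.
Proof.
move=> hE h0.
transitivity (\sum_i \sum_(aq : edge (ord i) * {ffun 'I_(ord i) -> 'I_N})
    h' (mk_sample aq.1 aq.2)).
  by rewrite sig_big_dep/=; apply: eq_bigr => -[i [a q]].
apply: eq_bigr => i _.
rewrite (pair_big (mem (sg_edges (H i))) (fun q : {ffun 'I_(ord i) -> 'I_N} => injectiveb q))/=.
rewrite [RHS]big_mkcond; apply: eq_bigr => -[a q] _ /=.
by case: ifP => [/andP[aA qI]|/negbT]; [exact: hE | exact: h0].
Qed.

Let n0 : (#|{: edge N}|%:R : R) != 0.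
Proof. by rewrite pnatr_eq0 -lt0n; apply/card_gt0P; exists e0. Qed.

Let n2 : (N * (N - 1))%N%:R = 2 * #|{: edge N}|%:R :> R.
Proof.
by have := bin_ffact N 2; rewrite ffactnS ffactn1 card_edge -natrM subn1 mulnC => ->.
Qed.

Lemma grad_sample e X : grad e X = \sum_z weight z * feature z e X.
Proof.
rewrite (sum_sample (h := fun i a q => 2 * beta i / (N ^_ ord i)%:R *
  subprod (sg_edges (H i)) a (actf (move_edge (emap e0 q a) e) q) X)); last first.
- by move=> i a q /negbTE h; rewrite /= h mul0r.
- by move=> i a q aA qI /=; rewrite aA qI.
apply: eq_bigr => i _; apply: eq_bigr => a _.
rewrite -!mulr_sumr (sum_emap_eq e0 a e (fun q => subprod (sg_edges (H i)) a q X)).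
by rewrite /scale n2; ring.
Qed.

Let sumD : R := \sum_i `|beta i| * (#|sg_edges (H i)| ^ 2)%N%:R.

Lemma Cbeta_bound : 2 * sumD <= Cbeta H beta / 6.
Proof. by rewrite /Cbeta ler_pdivlMr// le_max; apply/orP; left; rewrite -/sumD; lra. Qed.

(** Covers graphs with more than [N] vertices, where the falling factorial vanishes and 0 / 0 is
    0. *)
Let ratio_le1 (k : nat) : k%:R / k%:R <= 1 :> R.
Proof.
have [->|k0] := eqVneq k 0%N; first by rewrite mul0r.
by rewrite divff// pnatr_eq0.
Qed.

Let sum_inj m (x : R) : \sum_(q : {ffun 'I_m -> 'I_N} | injectiveb q) x = x * (N ^_ m)%:R.
Proof.
rewrite sumr_const -[LHS]mulr_natr; congr (x * _%:R).
by have := card_inj_ffuns 'I_m 'I_N; rewrite !card_ord cardsE => <-; exact: eq_card.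
Qed.

Let edges_le_sqr i : (#|sg_edges (H i)|%:R : R) <= (#|sg_edges (H i)| ^ 2)%N%:R.
Proof. by rewrite ler_nat; case: #|_| => // k; rewrite expnS expn1 leq_pmulr. Qed.

Lemma sum_weight : \sum_z `|weight z| <= Cbeta H beta / 6.
Proof.
apply: le_trans Cbeta_bound.
rewrite (sum_sample (h := fun i a q => 2 * `|beta i| / (N ^_ ord i)%:R)); last first.
- by move=> i a q /negbTE h; rewrite /= h normr0.
- move=> i a q aA qI /=; rewrite aA qI normrM normfV (ger0_norm (ler0n _ _)).
  by rewrite normrM (ger0_norm (ler0n _ 2)).
rewrite mulr_sumr; apply: ler_sum => i _.
under eq_bigr do rewrite sum_inj.
rewrite sumr_const -[X in X <= _]mulr_natr.
set r := (N ^_ ord i)%:R; set E := #|_|%:R.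
have -> : 2 * `|beta i| / r * r * E = 2 * (`|beta i| * (r / r * E)) by ring.
do 2 (apply: ler_wpM2l => //); apply: le_trans (edges_le_sqr i).
by rewrite ler_piMl ?ler0n// ratio_le1.
Qed.

Lemma card_seen i (a : edge (ord i)) (q : {ffun 'I_(ord i) -> 'I_N}) :
  (#|seen (mk_sample a q)| <= #|sg_edges (H i)| * (2 * N))%N.
Proof.
rewrite /seen /= -sum_nat_const.
elim/big_rec2: _ => [|b S k _ leS]; first by rewrite cards0.
apply: leq_trans (leq_card_setU _ _) _; rewrite leq_add//.
by apply: leq_trans (leq_card_setU _ _) _; rewrite mul2n -addnn leq_add// card_star.
Qed.

(** One factor [|E(H_i)|] counts the edges [a], the other comes from the size of [seen]; together
    they give the square in [Cbeta]. *)
Lemma sum_weight_seen :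
  \sum_z `|weight z| * #|seen z|%:R <= Cbeta H beta / 6 * (2 * N%:R).
Proof.
apply: le_trans (ler_wpM2r _ Cbeta_bound); last by rewrite mulr_ge0 ?ler0n.
rewrite (sum_sample (h := fun i a q =>
  2 * `|beta i| / (N ^_ ord i)%:R * #|seen (mk_sample a q)|%:R)); last first.
- by move=> i a q /negbTE h; rewrite /= h normr0 mul0r.
- move=> i a q aA qI /=; rewrite aA qI normrM normfV (ger0_norm (ler0n _ _)).
  by rewrite normrM (ger0_norm (ler0n _ 2)).
rewrite mulr_sumr mulr_suml; apply: ler_sum => i _.
set E := #|sg_edges (H i)|.
apply: (@le_trans _ _ (\sum_(a in sg_edges (H i))
    \sum_(q : {ffun 'I_(ord i) -> 'I_N} | injectiveb q)
      2 * `|beta i| / (N ^_ ord i)%:R * (E * (2 * N))%N%:R)).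
  apply: ler_sum => a _; apply: ler_sum => q _; apply: ler_wpM2l.
    by rewrite mulr_ge0 ?invr_ge0 ?ler0n// mulr_ge0.
  by rewrite ler_nat card_seen.
under eq_bigr do rewrite sum_inj.
rewrite sumr_const -[X in X <= _]mulr_natr -/E expnS expn1 !natrM.
set r := (N ^_ ord i)%:R; set F : R := E%:R.
have -> : 2 * `|beta i| / r * (F * (2 * N%:R)) * r * F
  = r / r * (2 * (`|beta i| * (F * F)) * (2 * N%:R)) by ring.
by rewrite ler_piMl ?ratio_le1// !mulr_ge0 ?ler0n.
Qed.

Lemma feature_le1 z e (G : graph N) : `|feature z e (emb R G)| <= 1.
Proof.
case: z => i [a q]; rewrite /feature /subprod.
elim/big_ind: _ => [|x y x1 y1|b _]; first by rewrite normr1.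
  by rewrite normrM mulr_ile1.
by rewrite /emb; case: (G _); rewrite ?normr1 ?normr0 ?lexx ?ler01.
Qed.

(** Each factor is the value of [X] at the moved image of an edge [b] other than [a]. By
    [move_edge_off] this edge has an endpoint among the [q u] and the images of the endpoints of
    [a], so it lies in a star contained in [seen z]. *)
Lemma feature_seen z e X X' : weight z != 0 -> {in seen z, X =1 X'} ->
  feature z e X = feature z e X'.
Proof.
case: z => i [a q] /=; case: ifP; last by rewrite eqxx.
move=> /andP[aA qI] _ XX'; apply: eq_bigr => b; rewrite !inE => /andP[ba bA].
have sI := qI; rewrite -(actf_inj (move_edge (emap e0 q a) e)) in sI.
apply: XX'; set s := move_edge _ _.
have /injectiveP qI' := qI.
have qa : q (val a).1 != q (val a).2 by rewrite (inj_eq qI') edge_neq.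
(* As [b <> a], some endpoint of [b] is not an endpoint of [a]. *)
have [u ub ua] : exists2 u, (u == (val b).1) || (u == (val b).2)
    & (u != (val a).1) && (u != (val a).2).
  have [b1|] := boolP (((val b).1 != (val a).1) && ((val b).1 != (val a).2)).
    by exists (val b).1; rewrite ?eqxx.
  have [b2|] := boolP (((val b).2 != (val a).1) && ((val b).2 != (val a).2)).
    by exists (val b).2; rewrite ?eqxx ?orbT.
  rewrite !negb_and !negbK => h2 h1; exfalso; move: ba => /negP; apply.
  rewrite -val_eqE; move: h1 h2 (valP a) (valP b).
  case: (val b) => b1 b2; case: (val a) => a1 a2 /=.
  move=> /orP[]/eqP-> /orP[]/eqP-> //; rewrite ?ltnn//.
  by move=> lt1 lt2; have := ltn_trans lt1 lt2; rewrite ltnn.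
set q' := actf s q.
have bstar : emap e0 q' b \in star (q' u).
  have /injectiveP q'I := sI.
  have q'b : q' (val b).1 != q' (val b).2 by rewrite (inj_eq q'I) edge_neq.
  rewrite /emap; case/orP: ub => /eqP->; first exact: mkedge_star.
  by rewrite mkedgeC// mkedge_star// eq_sym.
have q'u : q' u \in [:: q u; q (val a).1; q (val a).2].
  rewrite /q' ffunE /s; have := @move_edge_off _ (emap e0 q a) e (q u).
  rewrite /emap; case: (mkedgeP e0 qa) => -> /=; rewrite !(inj_eq qI').
    by case/andP: ua => u1 u2; apply.
  by case/andP: ua => u1 u2 /(_ u2 u1); rewrite !inE => /or3P[]->; rewrite ?orbT.
have seen_star b' v : b' \in sg_edges (H i) -> (v == (val b').1) || (v == (val b').2) ->
    star (q v) \subset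
      (\bigcup_(b in sg_edges (H i)) (star (q (val b).1) :|: star (q (val b).2)))%SET.
  move=> b'A vb; apply: (bigcup_max b') => //.
  by case/orP: vb => /eqP->; [exact: finset.subsetUl | exact: finset.subsetUr].
move: q'u; rewrite !inE => /or3P[]/eqP q'u; move: bstar; rewrite q'u.
- by apply/fintype.subsetP; exact: seen_star bA ub.
- by apply/fintype.subsetP; apply: (seen_star a); rewrite ?eqxx.
- by apply/fintype.subsetP; apply: (seen_star a); rewrite ?eqxx ?orbT.
Qed.

(** A product of 0/1 values changes by at most 1, and only if some factor is read at [c]. *)
Lemma prod_flip_diff m (A : {set edge m}) (f : edge m -> edge N) (G : graph N) c :
  `|\prod_(b in A) emb R G (f b) - \prod_(b in A) emb R (flip c G) (f b)|
    <= \sum_(b in A) (f b == c)%:R.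
Proof.
have [/existsP[b /andP[bA bc]]|none] := boolP [exists b, (b \in A) && (f b == c)].
  rewrite [X in _ <= X](bigD1 b)//= bc; apply: (@le_trans _ _ 1); last first.
    by rewrite lerDl sumr_ge0// => ? _; case: (_ == _).
  have P01 (X : graph N) : 0 <= \prod_(b in A) emb R X (f b) <= 1.
    elim/big_ind: _ => [|x y /andP[x0 x1] /andP[y0 y1]|? _]; first by rewrite ler01 lexx.
      by rewrite mulr_ge0// mulr_ile1.
    exact: emb01.
  have := P01 G; have := P01 (flip c G) => /andP[? ?] /andP[? ?].
  by rewrite ler_norml; apply/andP; split; lra.
have f_c b : b \in A -> f b != c.
  by move=> bA; apply: contra none => /eqP bc; apply/existsP; exists b; rewrite bA bc eqxx.
rewrite [X in _ - X](eq_bigr (fun b => emb R G (f b))); last first.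
  by move=> b /f_c bc; rewrite /emb flip_neq.
by rewrite subrr normr0 sumr_ge0// => ? _; case: (_ == _).
Qed.

(** A term changes only if some [b] other than [a] lands on [c]. Summing over [e] frees the image of
    [a], and [sum_emap_eq1] counts the maps sending [b] to [c]; their proportion 1/n compensates
    [N (N - 1)]. *)
Lemma grad_lipschitz (G : graph N) c :
  \sum_e `|grad e (emb R G) - grad e (emb R (flip c G))| <= Cbeta H beta / 6.
Proof.
apply: le_trans Cbeta_bound.
pose D i a (q : {ffun 'I_(ord i) -> 'I_N}) : R :=
  `|beta i| * scale i * \sum_(b in sg_edges (H i) :\ a) (emap e0 q b == c)%:R.
have scale0 i : 0 <= scale i by rewrite divr_ge0 ?ler0n.
apply: (@le_trans _ _ (\sum_e \sum_i \sum_(a in sg_edges (H i))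
    \sum_(q : {ffun 'I_(ord i) -> 'I_N} | injectiveb q && (emap e0 q a == e)) D i a q)).
  apply: ler_sum => e _; rewrite /grad -sumrB.
  apply: le_trans (ler_norm_sum _ _ _) _; apply: ler_sum => i _; rewrite -sumrB.
  apply: le_trans (ler_norm_sum _ _ _) _; apply: ler_sum => a _; rewrite -sumrB.
  apply: le_trans (ler_norm_sum _ _ _) _; apply: ler_sum => q _.
  rewrite -mulrBr normrM normrM (ger0_norm (scale0 i)); apply: ler_wpM2l.
    by rewrite mulr_ge0.
  exact: prod_flip_diff.
rewrite exchange_big mulr_sumr; apply: ler_sum => i _.
rewrite exchange_big/=.
apply: (@le_trans _ _ (\sum_(a in sg_edges (H i))
  2 * `|beta i| * #|sg_edges (H i)|%:R)); last first.
  by rewrite sumr_const -[X in X <= _]mulr_natr expnS expn1 natrM -!mulrA.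
apply: ler_sum => a aA.
rewrite -(partition_big (fun q : {ffun 'I_(ord i) -> 'I_N} => emap e0 q a) xpredT)//=.
rewrite -mulr_sumr.
apply: (@le_trans _ _ (`|beta i| * scale i *
  \sum_(b in sg_edges (H i)) ((N ^_ ord i)%:R / #|{: edge N}|%:R))).
  apply: ler_wpM2l; first by rewrite mulr_ge0.
  rewrite exchange_big/= [X in _ <= X](big_setD1 a aA)/=.
  apply: ler_wpDl; first by rewrite divr_ge0 ?ler0n.
  apply: ler_sum => b _; rewrite -(sum_emap_eq1 e0 _ b c) mulrC mulKf//.
  by rewrite [X in _ <= X]big_mkcondr/=; apply: ler_sum => q _; case: ifP.
rewrite sumr_const -[X in _ * X]mulr_natr /scale n2.
set n : R := #|{: edge N}|%:R; set r := (N ^_ ord i)%:R; set E := #|_|%:R.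
have -> : `|beta i| * (2 * n / r) * (r / n * E) = n / n * (r / r * (2 * `|beta i| * E)) by ring.
rewrite divff// mul1r ler_piMl ?ratio_le1//.
by rewrite !mulr_ge0 ?ler0n.
Qed.

(** As [q] is injective, every monomial of [grad] is square-free and [indep_pmf_prod] applies. *)
Lemma grad_indep (P : edge N -> R) e :
  \sum_Y indep_pmf P Y * grad e (emb R Y) = grad e P.
Proof.
rewrite /grad; under eq_bigr do rewrite mulr_sumr.
rewrite exchange_big; apply: eq_bigr => i _.
under eq_bigr do rewrite mulr_sumr.
rewrite exchange_big; apply: eq_bigr => a _.
under eq_bigr do rewrite mulr_sumr.
rewrite exchange_big; apply: eq_bigr => q /andP[/injectiveP qI _].
under eq_bigr do rewrite mulrCA.
rewrite -mulr_sumr; congr (_ * _); rewrite /subprod.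
have imE X : \prod_(b in sg_edges (H i) :\ a) X (emap e0 q b) =
    \prod_(e in emap e0 q @: (sg_edges (H i) :\ a)) X e.
  by rewrite big_imset//= => b b' _ _; exact: emap_inj.
rewrite imE -indep_pmf_prod; apply: eq_bigr => Y _; by rewrite imE.
Qed.

End GradientPolynomial.

(** * Finitely supported probability measures *)

Section FiniteMixture.
Context d (T : measurableType d) (R : realType) (I : finType) (i0 : I).
Variables (w : I -> R) (a : I -> T).
Hypothesis w0 : forall i, 0 <= w i.

Let m_ k := mscale (NngNum (w0 (nth i0 (index_enum I) k)))
  (dirac (a (nth i0 (index_enum I) k))).

(** [w1] is an argument so that the probability instance below can be attached to the term. The
    point [i0] is the default value of [nth]. *)
Definition finite_mixture (w1 : \sum_i w i = 1) : set T -> \bar R :=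
  msum m_ (size (index_enum I)).

Hypothesis w1 : \sum_i w i = 1.

HB.instance Definition _ := Measure.on (finite_mixture w1).

Lemma finite_mixtureE A : finite_mixture w1 A = (\sum_i w i * \1_A (a i))%:E.
Proof.
rewrite /finite_mixture /msum -(big_mkord xpredT (fun k => m_ k A)).
rewrite -(big_nth i0 xpredT (fun i => mscale (NngNum (w0 i)) (dirac (a i)) A)).
rewrite -sumEFin; apply: eq_bigr => i _.
by rewrite /mscale/= diracE EFinM indicE.
Qed.

Let finite_mixture_setT : finite_mixture w1 setT = 1%E.
Proof.
rewrite finite_mixtureE -w1; congr (_%:E); apply: eq_bigr => i _.
by rewrite indicT mulr1.
Qed.

HB.instance Definition _ :=
  Measure_isProbability.Build _ _ _ (finite_mixture w1) finite_mixture_setT.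

Lemma integral_finite_mixture A (h : T -> R) :
  measurable A -> (forall i, A (a i)) -> (forall x, A x -> 0 <= h x) ->
  measurable_fun A h ->
  (\int[finite_mixture w1]_(x in A) (h x)%:E = (\sum_i w i * h (a i))%:E)%E.
Proof.
move=> mA aA h0 mh; rewrite ge0_integral_measure_sum//; last exact/measurable_EFinP.
rewrite -(big_mkord xpredT (fun k => \int[m_ k]_(x in A) (h x)%:E)%E).
rewrite -(big_nth i0 xpredT
  (fun i => \int[mscale (NngNum (w0 i)) (dirac (a i))]_(x in A) (h x)%:E)%E).
rewrite -sumEFin; apply: eq_bigr => i _.
rewrite ge0_integral_mscale//; last exact/measurable_EFinP.
rewrite integral_dirac//; last exact/measurable_EFinP.
by rewrite diracE mem_set// mul1e EFinM.
Qed.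

End FiniteMixture.

(** * Measurability on the space of edge vectors *)

Section MeasurableRn.
Variables (R : realType) (N : nat).

Lemma measurable_coord (e : edge N) : measurable_fun setT (fun X : Rn R N => X e).
Proof.
move=> _ A mA; rewrite setTI; apply: sub_sigma_algebra.
by exists e, A.
Qed.

Lemma measurable_cube : measurable (@cube R N : set (Rn R N)).
Proof.
have -> : @cube R N = \bigcap_(e in setT) ((fun X : Rn R N => X e) @^-1` `[0, 1]%classic).
  apply/seteqP; split=> X /= XC e; first by move=> _ /=; rewrite in_itv/=; exact: XC.
  by have := XC e I; rewrite /= in_itv.
apply: fin_bigcap_measurable => [|e _].
  exact: finite_finset.
rewrite -[X in measurable X]setTI.
exact: measurable_coord.
Qed.

Lemma measurable_sum_cond (I : finType) (P : pred I) (h : I -> Rn R N -> R) :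
  (forall i, measurable_fun setT (h i)) ->
  measurable_fun setT (fun X => \sum_(i | P i) h i X).
Proof.
move=> mh; under [X in measurable_fun _ X]funext do rewrite -big_filter.
exact: measurable_sum.
Qed.

Lemma measurable_prod_cond (I : finType) (P : pred I) (h : I -> Rn R N -> R) :
  (forall i, measurable_fun setT (h i)) ->
  measurable_fun setT (fun X => \prod_(i | P i) h i X).
Proof.
move=> mh; under [X in measurable_fun _ X]funext do rewrite -big_filter.
by apply: measurable_prod => i _.
Qed.

Lemma measurable_indep_pmf (G : graph N) :
  measurable_fun setT (fun X : Rn R N => indep_pmf X G).
Proof.
apply: measurable_prod_cond => e; case: (G e); first exact: measurable_coord.
by apply: measurable_funB => //; exact: measurable_coord.
Qed.

Lemma measurable_pder (l : nat) (H : 'I_l -> sgraph) (beta : 'I_l -> R) (e : edge N) :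
  measurable_fun setT (fun X : Rn R N => pder (subgraph_count H beta) e X).
Proof.
(* The polynomial form reduces measurability to sums and products of coordinates; [e] itself serves
   as the junk edge. *)
have -> : (fun X : Rn R N => pder (subgraph_count H beta) e X) =
    (fun X => grad e H beta e X / 2).
  by apply/funext => X; exact: pder_grad.
apply: measurable_funM => //.
do 3 apply: measurable_sum_cond => ?.
apply: measurable_funM => //.
by apply: measurable_prod_cond => b; exact: measurable_coord.
Qed.

Lemma continuous_tanhR : continuous (@tanhR R).
Proof.
move=> x; apply: cvgM.
  apply: cvgB; first exact: continuous_expR.
  by apply: (@continuous_comp _ _ _ -%R); [exact: opp_continuous | exact: continuous_expR].
apply: cvgV; first by rewrite gt_eqF// addr_gt0 ?expR_gt0.
apply: cvgD; first exact: continuous_expR.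
by apply: (@continuous_comp _ _ _ -%R); [exact: opp_continuous | exact: continuous_expR].
Qed.

Lemma measurable_Xset (l : nat) (H : 'I_l -> sgraph) (beta : 'I_l -> R) (C : R) :
  measurable (@Xset R N (subgraph_count H beta) C : set (Rn R N)).
Proof.
apply: measurable_fun_le; [exact: measurable_cube | | exact: measurable_cst].
apply: (measurable_funS measurableT) => //; apply: measurable_sum => e.
apply: (measurableT_comp (@normr_measurable R setT)).
apply: measurable_funB; first exact: measurable_coord.
apply: measurable_funM => //; apply: measurable_funD => //.
apply: (measurableT_comp (continuous_measurable_fun continuous_tanhR)).
exact: measurable_pder.
Qed.

End MeasurableRn.

(** * Conditional edge probabilities of the exponential random graph *)

Section Gibbs.
Variables (R : realType) (N : nat) (f : (edge N -> R) -> R).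

Lemma ergm_ge0 G : 0 <= ergm f G.
Proof. by rewrite divr_ge0 ?expR_ge0// sumr_ge0// => ? _; exact: expR_ge0. Qed.

Let Z_gt0 : 0 < \sum_(G' : graph N) expR (f (emb R G')).
Proof.
rewrite (bigD1 (finfun (fun=> true)))//= ltr_wpDr ?expR_gt0//.
by apply: sumr_ge0 => ? _; exact: expR_ge0.
Qed.

Lemma ergm_sum1 : \sum_G ergm f G = 1.
Proof. by rewrite /ergm -mulr_suml divff// gt_eqF. Qed.

Definition edge_mean e (G : graph N) : R := (1 + tanhR (pder f e (emb R G))) / 2.

Lemma upd_flip e (G : graph N) b : upd (emb R (flip e G)) e b = upd (emb R G) e b.
Proof. by apply/funext => e'; rewrite /upd /emb; case: eqVneq => // ne; rewrite flip_neq. Qed.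

Lemma edge_mean_flip e (G : graph N) : edge_mean e (flip e G) = edge_mean e G.
Proof. by rewrite /edge_mean /pder !upd_flip. Qed.

(** With [A] and [B] the values of [f] with [e] present and absent, both weights share the factor
    exp ((A + B) / 2); what remains is the form of [half_tanhE] at (A - B) / 2. *)
Lemma ergm_edge_mean e (G : graph N) :
  ergm f G * (emb R G e - edge_mean e G)
    + ergm f (flip e G) * (emb R (flip e G) e - edge_mean e G) = 0.
Proof.
have updE (X : graph N) : emb R X = upd (emb R X) e (X e)%:R.
  by apply/funext => e'; rewrite /upd /emb; case: eqVneq => // ->.
have GE := updE G; have FE := updE (flip e G).
rewrite upd_flip flip_id in FE.
rewrite /ergm FE GE /edge_mean half_tanhE /pder.
have -> : upd (upd (emb R G) e (G e)%:R) e = upd (emb R G) e.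
  by apply/funext => b; apply/funext => e'; rewrite /upd; case: eqVneq.
have Z0 := gt_eqF Z_gt0; set Z := \sum_G' _ in Z0 *.
set A := f (upd _ e 1); set B := f (upd _ e 0).
have expA : expR A = expR ((A - B) / 2) * expR ((A + B) / 2).
  by rewrite -expRD; congr expR; lra.
have expB : expR B = expR (- ((A - B) / 2)) * expR ((A + B) / 2).
  by rewrite -expRD; congr expR; lra.
have ab0 : 0 < expR ((A - B) / 2) + expR (- ((A - B) / 2)) by rewrite addr_gt0 ?expR_gt0.
rewrite {2 4}/upd eqxx.
case: (G e) => /=; rewrite -/A -/B expA expB; field; by rewrite Z0 gt_eqF.
Qed.

End Gibbs.

(** * Resampling the exponential random graph outside [S] *)

Section Mixture.
Variables (R : realType) (N : nat) (e0 : edge N).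
Variables (l : nat) (H : 'I_l -> sgraph) (beta : 'I_l -> R).
Variables (S : {set edge N}) (ghat : edge N -> graph N -> R).
Hypothesis ghatS : forall e (G G' : graph N), {in S, G =1 G'} -> ghat e G = ghat e G'.

Let f := @subgraph_count R N l H beta.
Let C := Cbeta H beta.
Let nu := ergm f.
Let g e (G : graph N) := grad e0 H beta e (emb R G).
Let eps := \sum_G nu G * \sum_e `|g e G - ghat e G|.

(** The support points of [rho]: edges of [S] are frozen, the others get their approximate
    conditional probability. *)
Definition means e (G : graph N) : R :=
  if e \in S then emb R G e else (1 + tanhR (ghat e G / 2)) / 2.

Let edge_meanE e G : edge_mean f e G = (1 + tanhR (g e G / 2)) / 2.
Proof. by rewrite /edge_mean (pder_grad e0). Qed.

Lemma means01 e G : 0 <= means e G <= 1.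
Proof.
by rewrite /means; case: ifP => _; [exact: emb01 | rewrite half_tanh_ge0 half_tanh_le1].
Qed.

Let agree_flip e G : e \notin S -> {in S, flip e G =1 G}.
Proof. by move=> eS c cS; rewrite flip_neq//; apply: contraNneq eS => <-. Qed.

Lemma means_flip e c G : e \notin S -> means c (flip e G) = means c G.
Proof.
move=> eS; rewrite /means; case: ifP => [cS|_]; first by rewrite /emb agree_flip.
by rewrite (ghatS _ (agree_flip G eS)).
Qed.

Let r := enum (~: S)%SET.
Let rS : {in r, forall e, e \notin S}.
Proof. by move=> e; rewrite mem_enum inE. Qed.

Lemma hybrid_means G : hybrid means r G =1 means^~ G.
Proof.
move=> e; rewrite /hybrid mem_enum inE /means; case: (e \in S) => //.
Qed.

Lemma half_tanh_half x y : `|(1 + tanhR (x / 2)) / 2 - (1 + tanhR (y / 2)) / 2| <= `|x - y| :> R.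
Proof.
apply: le_trans (half_tanh_lipschitz _ _) _.
by rewrite -mulrBl normrM (@ger0_norm _ 2^-1) ?invr_ge0//; lra.
Qed.

Lemma sum_cost : \sum_(e <- r) 2 * \sum_G nu G * `|means e G - edge_mean f e G| <= 2 * eps.
Proof.
rewrite -mulr_sumr ler_pM2l// /eps.
under [X in _ <= X]eq_bigr do rewrite mulr_sumr.
rewrite [X in _ <= X]exchange_big/= [X in X <= _]big_enum/= [X in X <= _]big_mkcond/=.
apply: ler_sum => e _; case: ifP => [|_]; last first.
  by apply: sumr_ge0 => G _; rewrite mulr_ge0// ergm_ge0.
rewrite inE => eS; apply: ler_sum => G _; apply: ler_wpM2l; first exact: ergm_ge0.
by rewrite /means (negbTE eS) edge_meanE distrC; exact: half_tanh_half.
Qed.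

Lemma mixture_coupled :
  coupled (fun Y => \sum_G nu G * indep_pmf (means^~ G) Y) nu (2 * eps).
Proof.
have [pi [pi0 pi1 pi2 pid]] := mix_coupled (ergm_ge0 f) (edge_mean_flip f)
  (ergm_edge_mean f) means01 (fun e c G => @means_flip e c G) (enum_uniq _) rS.
exists pi; split=> //; last exact: le_trans pid sum_cost.
move=> Y; rewrite pi1; apply: eq_bigr => G _.
by rewrite (indep_pmf_eq _ (hybrid_means G)).
Qed.

Lemma indep_means_supp G Y : indep_pmf (means^~ G) Y != 0 -> {in S, Y =1 G}.
Proof.
move=> h e eS; move: h; rewrite (indep_pmfE e) mulf_eq0 negb_or => /andP[+ _].
by rewrite /means eS /emb; case: (Y e); case: (G e); rewrite ?subrr ?eqxx.
Qed.

Definition residual (G : graph N) : R :=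
  \sum_e `|grad e0 H beta e (means^~ G) - ghat e G|.

(** By [grad_indep], [grad] at [means] is the average of [g] over the resampled graph, which agrees
    with [G] on [S] and so has the same [ghat]. Hence the residual is at most the mean of [phi]
    after resampling, and [phi] is C/6-Lipschitz off [S] while resampling costs [2 * eps]. *)
Lemma sum_residual : \sum_G nu G * residual G <= (1 + C / 3) * eps.
Proof.
pose phi Y := \sum_e `|g e Y - ghat e Y|.
have phiL e Y : e \notin S -> `|phi Y - phi (flip e Y)| <= C / 6.
  move=> eS; apply: le_trans (grad_lipschitz e0 H beta Y e).
  rewrite /phi -sumrB; apply: le_trans (ler_norm_sum _ _ _) _; apply: ler_sum => c _.
  rewrite (ghatS _ (agree_flip Y eS)); apply: le_trans (ler_dist_dist _ _) _.
  by rewrite opprB addrA subrK.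
have /le_trans := mix_lipschitz (ergm_ge0 f) (edge_mean_flip f)
  (ergm_edge_mean f) means01 (fun e c G => @means_flip e c G) phiL (enum_uniq _) rS.
have C0 : 0 <= C by rewrite /C /Cbeta le_max ler0n orbT.
have le2 : \sum_Y nu Y * phi Y +
   C / 6 * (\sum_(e <- r) 2 * \sum_G nu G * `|means e G - edge_mean f e G|) <= (1 + C / 3) * eps.
  have := ler_wpM2l (divr_ge0 C0 (ler0n _ 6)) sum_cost; rewrite -/eps; lra.
move=> /(_ _ le2); apply: le_trans.
rewrite /mix; under [X in _ <= X]eq_bigr do rewrite mulr_suml.
rewrite exchange_big/=; apply: ler_sum => G _.
under eq_bigr do rewrite -mulrA.
rewrite -mulr_sumr; apply: ler_wpM2l; first exact: ergm_ge0.
under eq_bigr do rewrite /phi mulr_sumr.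
rewrite exchange_big/=; apply: ler_sum => e _.
rewrite -(grad_indep e0 H beta) -[X in _ - X]mul1r -(indep_pmf_sum1 (means^~ G)) mulr_suml -sumrB.
apply: le_trans (ler_norm_sum _ _ _) _; apply: ler_sum => Y _.
rewrite (indep_pmf_eq _ (hybrid_means G)) -mulrBr normrM.
rewrite (ger0_norm (indep_pmf_ge0 _ (fun e => means01 e G))).
have [->|/indep_means_supp YG] := eqVneq (indep_pmf (means^~ G) Y) 0; first by rewrite !mul0r.
by rewrite (ghatS e YG).
Qed.

(** Each edge of [S] contributes at most 1; elsewhere the logistic map of a halved argument is
    1-Lipschitz. *)
Lemma l1_means G :
  l1 (fun e => means e G - (1 + tanhR (pder f e (means^~ G))) / 2) <= #|S|%:R + residual G.
Proof.
rewrite -sum1_card natr_sum big_mkcond -big_split/=; apply: ler_sum => e _.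
rewrite /f (pder_grad e0) {1}/means; case: ifP => eS; last first.
  by rewrite add0r distrC; exact: half_tanh_half.
apply: (@le_trans _ _ 1); last by rewrite lerDl.
have := half_tanh_ge0 (grad e0 H beta e (means^~ G) / 2).
have := half_tanh_le1 (grad e0 H beta e (means^~ G) / 2).
by have /andP[] := emb01 R G e => ? ? ? ?; rewrite ler_norml; apply/andP; split; lra.
Qed.

(** Markov's inequality for [residual] at level [theta]; below it, [l1_means] puts the parameter
    vector in [Xset]. *)
Lemma Xset_mass (theta : R) : 0 < theta ->
  #|S|%:R + theta <= 5000 * C ^+ 2 * ((nedges N)%:R `^ (15 / 16)) ->
  1 - (1 + C / 3) * eps / theta <= \sum_G nu G * \1_(@Xset R N f C) (means^~ G).
Proof.
move=> th0 hS.
have h : \sum_G nu G - \sum_G nu G * \1_(@Xset R N f C) (means^~ G) <=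
    \sum_G nu G * (residual G / theta).
  rewrite -sumrB; apply: ler_sum => G _; rewrite -[X in X - _]mulr1 -mulrBr.
  apply: ler_wpM2l; first exact: ergm_ge0.
  have res0 : 0 <= residual G by apply: sumr_ge0.
  rewrite indicE; case: (boolP (_ \in _)) => [_|].
    by rewrite subrr divr_ge0// ltW.
  move=> /negP notX; rewrite subr0 ler_pdivlMr// mul1r leNgt; apply/negP => lt_th.
  apply: notX; rewrite inE; split; first by move=> e; exact: means01.
  apply: le_trans hS; apply: le_trans (l1_means G) _; rewrite lerD2l; exact: ltW.
have : \sum_G nu G * (residual G / theta) <= (1 + C / 3) * eps / theta.
  under eq_bigr do rewrite mulrA.
  by rewrite -mulr_suml ler_pM2r ?invr_gt0// sum_residual.
move: h; rewrite [X in X - _](ergm_sum1 f); lra.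
Qed.

End Mixture.

(** * Sampling the gradient and choosing the parameters *)

Lemma sampled_gradient (R : realType) (N : nat) (e0 : edge N) (l : nat)
    (H : 'I_l -> sgraph) (beta : 'I_l -> R) (mu : graph N -> R) (j : nat) :
  (forall G, 0 <= mu G) -> \sum_G mu G = 1 -> (0 < j)%N ->
  exists (S : {set edge N}) (ghat : edge N -> graph N -> R),
    [/\ forall e (G G' : graph N), {in S, G =1 G'} -> ghat e G = ghat e G',
        \sum_G mu G * \sum_e `|grad e0 H beta e (emb R G) - ghat e G|
          <= Cbeta H beta / 4 * #|{: edge N}|%:R / j%:R &
        #|S|%:R <= 4 * j%:R ^+ 2 * N%:R :> R].
Proof.
move=> mu0 mu1 j0; set C := Cbeta H beta.
have C2 : 2 <= C by rewrite /C /Cbeta le_max lexx orbT.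
have N0 : 0 < N%:R :> R by rewrite ltr0n; apply: leq_ltn_trans (ltn_ord (val e0).1).
(* Sampling is done for all edges at once, under [mu] times counting measure, so that the same
   samples, and hence the same [S], serve every [e]. *)
pose V := (graph N * edge N)%type.
have pairE (h : graph N -> edge N -> R) : \sum_(v : V) h v.1 v.2 = \sum_G \sum_e h G e.
  by rewrite pair_bigA.
have massE : \sum_(v : V) mu v.1 = #|{: edge N}|%:R.
  rewrite (pairE (fun G _ => mu G)); under eq_bigr do rewrite sumr_const -mulr_natr.
  by rewrite -mulr_suml mu1 mul1r.
have mass0 : 0 < \sum_(v : V) mu v.1.
  by rewrite massE ltr0n; apply/card_gt0P; exists e0.
have [|||||||s [err cost]] := @maurey_l1 R (sample N H) V (weight beta)
    (fun z v => feature e0 z v.2 (emb R v.1)) (fun v => mu v.1)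
    (fun z => #|seen z|%:R) (C / 6) (2 * N%:R) j _ _ j0 _ _ mass0 _ _ _.
- lra.
- lra.
- by move=> z v; exact: feature_le1.
- by [].
- by [].
- exact: sum_weight.
- exact: sum_weight_seen.
pose S : {set edge N} := (\bigcup_(z <- s) seen z)%SET.
exists S, (fun e G => C / 6 / j%:R ^+ 2 *
  \sum_(z <- s) Num.sg (weight beta z) * feature e0 z e (emb R G)); split.
- move=> e G G' GG'; congr (_ * _); apply: eq_big_seq => z zs.
  (* Samples of weight 0, to which [feature_seen] does not apply, are killed by their sign. *)
  have [->|wz] := eqVneq (weight beta z) 0; first by rewrite sgr0 !mul0r.
  congr (_ * _); apply: feature_seen wz _ => c cz; rewrite /emb GG'//.
  by rewrite /S (big_rem z zs)/= inE cz.
- move: err; rewrite massE.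
  rewrite (pairE (fun G e => mu G * `|\sum_z weight beta z * feature e0 z e (emb R G) -
    C / 6 / j%:R ^+ 2 * \sum_(z <- s) Num.sg (weight beta z) * feature e0 z e (emb R G)|)).
  under eq_bigr do rewrite -mulr_sumr.
  move=> err; have -> : C / 4 = 3 / 2 * (C / 6) by lra.
  apply: le_trans err; apply: ler_sum => G _; apply: ler_wpM2l => //.
  by apply: ler_sum => e _; rewrite grad_sample.
- apply: (@le_trans _ _ (\sum_(z <- s) #|seen z|%:R)); last by lra.
  rewrite -natr_sum ler_nat /S.
  elim/big_rec2: _ => [|z k A _ leA]; first by rewrite cards0.
  by apply: leq_trans (leq_card_setU _ _) _; rewrite leq_add2l.
Qed.

Theorem theorem10 (R : realType) (N : nat) (hN : (2 <= N)%N)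
    (l : nat) (H : 'I_l -> sgraph) (beta : 'I_l -> R) :
  let f : (edge N -> R) -> R := @subgraph_count R N l H beta in
  let C := Cbeta H beta in
  let n := (nedges N)%:R : R in
  exists rho : probability (Rn R N) R,
    [/\ rho (@cube R N) = 1%E,
        is_mixture rho (@ergm R N f) (80 * C * n `^ (- (1 / 16))),
        measurable (@Xset R N f C : set (Rn R N)) &
        ((1 - 80 * C / n `^ (1 / 16))%:E <= rho (@Xset R N f C))%E].
Proof.
move=> f C n.
have C2 : 2 <= C by rewrite /C /Cbeta le_max lexx orbT.
pose e0 : edge N := Sub (Ordinal (ltnW hN), Ordinal hN) isT.
have nE : n = #|{: edge N}|%:R by rewrite card_edge.
have n1 : 1 <= n by rewrite nE ler1n; apply/card_gt0P; exists e0.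
(* All bounds become powers of [x]: n is [x ^+ 16] and N is at most [2 * x ^+ 8]. *)
set x := n `^ (1 / 16).
have xk (k : nat) : x ^+ k = n `^ (k%:R / 16).
  by rewrite -powR_mulrn ?powR_ge0// /x -powRrM; congr (_ `^ _); lra.
have x16 : x ^+ 16 = n by rewrite xk divff ?pnatr_eq0// powRr1// (le_trans ler01).
have x1 : 1 <= x by rewrite /x -[X in X <= _](powRr0 n); apply: ler_powR => //; lra.
have x0 : 0 < x by exact: lt_le_trans x1.
have Nx : N%:R <= 2 * x ^+ 8.
  have x80 : 0 <= 2 * x ^+ 8 by rewrite mulr_ge0// exprn_ge0// ltW.
  rewrite -(ler_pXn2r (isT : (0 < 2)%N)) ?nnegrE ?ler0n//.
  rewrite exprMn -exprM x16 -natrX.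
  have -> : (2 : R) ^+ 2 * n = (4 * 'C(N, 2))%N%:R by rewrite natrM -natrX.
  rewrite ler_nat; have := bin_ffact N 2; rewrite ffactnS ffactn1 => h.
  have -> : (4 * 'C(N, 2) = 2 * (N * N.-1))%N by rewrite -h [(_ * 2`!)%N]mulnC mulnA.
  have le_double k : (2 <= k)%N -> (k <= k.-1.*2)%N.
    by case: k => [|[|k]]//= _; rewrite doubleS !ltnS -addnn leq_addr.
  by rewrite mulnCA expnS expn1 leq_mul2l mul2n le_double// orbT.
(* About n^(1/8), hence n^(1/4) samples: this gives [eps] of order [C * x ^+ 14] and [S] of order
   [x ^+ 12], both below [x ^+ 15]. *)
pose j := (Num.truncn (x ^+ 2)).+1.
have [jlo jhi] : x ^+ 2 <= j%:R /\ j%:R <= 2 * x ^+ 2 :> R.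
  have xx1 : 1 <= x ^+ 2 by rewrite expr_ge1// ltW.
  have /andP[] := Num.Theory.truncn_itv (le_trans ler01 xx1).
  by rewrite /j -natr1; split; lra.
have [S [ghat [ghatS]]] :=
  sampled_gradient e0 H beta (ergm_ge0 f) (ergm_sum1 f) (ltn0Sn _ : (0 < j)%N).
rewrite -/C -nE; set eps := \sum_G _ => eps_le S_le.
have x14 : eps <= C / 4 * x ^+ 14.
  apply: le_trans eps_le _; rewrite ler_pdivrMr ?ltr0n//.
  rewrite -x16 -[X in _ <= X]mulrA; apply: ler_wpM2l; first lra.
  have -> : x ^+ 16 = x ^+ 14 * x ^+ 2 by rewrite -exprD.
  by apply: ler_wpM2l => //; rewrite exprn_ge0// ltW.
have S12 : #|S|%:R <= 32 * x ^+ 12.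
  apply: le_trans S_le _.
  have -> : 32 * x ^+ 12 = 4 * (2 * x ^+ 2) ^+ 2 * (2 * x ^+ 8) by ring.
  rewrite ler_pM// ?mulr_ge0 ?exprn_ge0// ler_pM2l//.
  by rewrite lerXn2r// nnegrE ?ler0n// mulr_ge0// exprn_ge0// ltW.
have eps0 : 0 <= eps.
  by apply: sumr_ge0 => G _; rewrite mulr_ge0 ?ergm_ge0// sumr_ge0.
pose p G : Rn R N := (means S ghat)^~ G.
have p01 G : cube (p G) by move=> e; exact: means01.
pose rho : probability (Rn R N) R :=
  finite_mixture (finfun (fun=> true) : graph N) p (ergm_ge0 f) (ergm_sum1 f).
have rhoE A : rho A = (\sum_G ergm f G * \1_A (p G))%:E by exact: finite_mixtureE.
have x15 (k : nat) : (k <= 15)%N -> x ^+ k <= x ^+ 15 by move=> k15; rewrite ler_weXn2l.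
exists rho; split.
- rewrite rhoE -[RHS]/(1%R%:E) -(ergm_sum1 f); congr (_%:E); apply: eq_bigr => G _.
  by rewrite indicE mem_set// mulr1.
- have [pi [pi0 pi1 pi2 pid]] := mixture_coupled e0 H beta ghatS.
  exists pi; split=> //.
    move=> G; rewrite pi1 /GNrho_pmf; apply/esym.
    apply: (@integral_finite_mixture _ (Rn R N) R _ _ (ergm f) p (ergm_ge0 f)
      (ergm_sum1 f) (@cube R N) (fun P => indep_pmf P G)) => //.
    - exact: measurable_cube.
    - by move=> P P01; exact: indep_pmf_ge0.
    - by apply: measurable_funTS; exact: measurable_indep_pmf.
  apply: le_trans pid _; rewrite -/eps -/n powRN -/x -x16.
  have -> : 80 * C * x^-1 * x ^+ 16 = 80 * (C * x ^+ 15).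
    by field; rewrite gt_eqF.
  have := ler_wpM2l (_ : 0 <= C) (x15 14 isT); lra.
- exact: measurable_Xset.
- rewrite rhoE lee_fin.
  have xk0 k : 0 <= x ^+ k by rewrite exprn_ge0// ltW.
  have CC : 4 <= C ^+ 2 by have := sqr_ge0 (C - 2); nra.
  (* The Markov level is the order of magnitude allowed in [Xset], and exceeds the mean residual by
     a factor of order [x / C] or more, up to constants. *)
  have th0 : 0 < C ^+ 2 * x ^+ 15.
    by rewrite mulr_gt0 ?exprn_gt0//; lra.
  have hS : #|S|%:R + C ^+ 2 * x ^+ 15 <= 5000 * C ^+ 2 * (nedges N)%:R `^ (15 / 16).
    rewrite -/n -(xk 15%N).
    have := x15 12%N isT; have := ler_wpM2r (xk0 15%N) CC; lra.
  have := Xset_mass e0 ghatS th0 hS; apply: le_trans.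
  rewrite lerD2l lerN2 ler_pdivrMr//.
  have -> : 80 * C / x * (C ^+ 2 * x ^+ 15) = 80 * C ^+ 3 * x ^+ 14.
    by field; rewrite gt_eqF.
  (* Here 1 + C / 3 is at most C because C is at least 2. *)
  apply: (@le_trans _ _ (C * (C / 4 * x ^+ 14))).
    by apply: ler_pM; rewrite -?/C -?/eps //; lra.
  have : C ^+ 2 * x ^+ 14 <= C ^+ 3 * x ^+ 14.
    by apply: ler_wpM2r => //; apply: ler_weXn2l => //; lra.
  have := mulr_ge0 (sqr_ge0 C) (xk0 14%N); lra.
Qed.
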